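(* There is an absolute constant $c>0$ such that the following holds. Let $(\mathrm{Enc},\mathrm{Dec})$ be a quantum non-malleable code against $\mathsf{LO}^t$ with error $\varepsilon$ and blocklength $n$ qubits, such that for every message $\psi$ the state $\mathrm{Enc}(\psi)$ is separable across the $t$ shares. If the rate of the code is at least $1-\frac1t+\delta$ for some $\delta\ge 4\log n/n$, then $\varepsilon\ge c\,\delta^2$.
   Context: A quantum code on $t$ shares: CPTP maps $\mathrm{Enc}:\mathcal L(\mathcal H_M)\to\mathcal L(\mathcal H_{Q_1}\otimes\cdots\otimes\mathcal H_{Q_t})$, $\mathrm{Dec}$ in reverse, with $\mathrm{Dec}\circ\mathrm{Enc}=\mathrm{id}$; blocklength $n=\sum_i|Q_i|$ qubits, rate $k/n$ for $k$-qubit messages. $\mathsf{LO}^t$: channels $\Lambda_1\otimes\cdots\otimes\Lambda_t$ with $\Lambda_i$ CPTP on share $i$. Non-malleable with error $\varepsilon$: for every $\Lambda\in\mathsf{LO}^t$ there exist $p_\Lambda\in[0,1]$ and a state $\gamma_\Lambda$ depending only on $\Lambda$ such that for every message $\sigma_M$ with canonical purification $\sigma_{M\hat M}$, $\|(\mathrm{Dec}\circ\Lambda\circ\mathrm{Enc}\otimes\mathrm{id})(\sigma_{M\hat M})-(p_\Lambda\sigma_{M\hat M}+(1-p_\Lambda)\gamma_\Lambda\otimes\sigma_{\hat M})\|_1\le\varepsilon$. A multipartite state is separable if it is a convex combination of product states across the parts. *)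

(* Defs.v *)
From Stdlib Require Import ClassicalEpsilon.
From mathcomp Require Import all_boot all_order all_algebra.
From mathcomp Require Import all_classical all_reals exp realfun.
From mathcomp Require Import complex.
Import GRing.Theory Num.Theory.
Local Open Scope ring_scope.

Set Implicit Arguments.
Unset Strict Implicit.
Unset Printing Implicit Defensive.

Section Quantum.
Variable R : realType.
Local Notation C := (R[i]).

(* Operators on the Hilbert space C^I, I a finite index (basis) type. *)
Definition op (I : finType) := I -> I -> C.

Definition opmul (I : finType) (A B : op I) : op I :=
  fun x y => \sum_(z : I) A x z * B z y.
Definition adj (I : finType) (A : op I) : op I := fun x y => (A y x)^*.
Definition trace (I : finType) (A : op I) : C := \sum_(x : I) A x x.

Definition psd (I : finType) (A : op I) : Prop :=
  forall v : I -> C, 0 <= \sum_(x : I) \sum_(y : I) (v x)^* * A x y * v y.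

Definition density (I : finType) (A : op I) : Prop := psd A /\ trace A = 1.

Definition psd_sqrt (I : finType) (B : op I) : op I :=
  epsilon (inhabits (fun _ _ => 0 : C)) (fun P : op I => psd P /\ opmul P P = B).

Definition trnorm (I : finType) (A : op I) : R :=
  complex.Re (trace (psd_sqrt (opmul (adj A) A))).

Definition eunit (I : finType) (a b : I) : op I :=
  fun x y => ((x == a) && (y == b))%:R.

(* Phi (x) id_K, defined through the matrix units (valid for linear Phi) *)
Definition tens_id (I J K : finType) (Phi : op I -> op J) : op (I * K)%type -> op (J * K)%type :=
  fun X u v => \sum_(a : I) \sum_(b : I) X (a, u.2) (b, v.2) * Phi (eunit a b) u.1 v.1.

Definition is_linear (I J : finType) (Phi : op I -> op J) : Prop :=
  forall (a : C) (X Y : op I),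
    Phi (fun x y => a * X x y + Y x y) = (fun x y => a * Phi X x y + Phi Y x y).

Definition trace_preserving (I J : finType) (Phi : op I -> op J) : Prop :=
  forall X : op I, trace (Phi X) = trace X.

Definition completely_positive (I J : finType) (Phi : op I -> op J) : Prop :=
  forall (m : nat) (X : op (I * 'I_m)%type), psd X -> psd (tens_id Phi X).

Definition CPTP (I J : finType) (Phi : op I -> op J) : Prop :=
  [/\ is_linear Phi, completely_positive Phi & trace_preserving Phi].

Definition kron (I J : finType) (A : op I) (B : op J) : op (I * J)%type :=
  fun u v => A u.1 v.1 * B u.2 v.2.
Definition ptr1 (I J : finType) (X : op (I * J)%type) : op J :=
  fun r s => \sum_(a : I) X (a, r) (a, s).

(* canonical purification sigma_{M hat M} = |s><s|, |s> = sum_i (sqrt sigma |i>) (x) |i> *)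
Definition purif (I : finType) (sigma : op I) : op (I * I)%type :=
  fun u v => psd_sqrt sigma u.1 u.2 * (psd_sqrt sigma v.1 v.2)^*.

Definition qreg (m : nat) : finType := {ffun 'I_m -> bool}.

(* t shares, share i consisting of q i qubits *)
Definition cw (t : nat) (q : 'I_t -> nat) : finType := {dffun forall i : 'I_t, qreg (q i)}.
Definition blocklength (t : nat) (q : 'I_t -> nat) : nat := (\sum_(i < t) q i)%N.

Definition lo_tensor (t : nat) (q : 'I_t -> nat)
  (L : forall i : 'I_t, op (qreg (q i)) -> op (qreg (q i))) : op (cw q) -> op (cw q) :=
  fun X x y => \sum_(x' : cw q) \sum_(y' : cw q)
     X x' y' * \prod_(i < t) L i (eunit (x' i) (y' i)) (x i) (y i).

Definition in_LO (t : nat) (q : 'I_t -> nat) (Lam : op (cw q) -> op (cw q)) : Prop :=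
  exists L : forall i : 'I_t, op (qreg (q i)) -> op (qreg (q i)),
    (forall i, CPTP (L i)) /\ Lam = lo_tensor L.

Definition separable (t : nat) (q : 'I_t -> nat) (rho : op (cw q)) : Prop :=
  exists (m : nat) (w : 'I_m -> R) (r : 'I_m -> forall i : 'I_t, op (qreg (q i))),
    [/\ forall j, 0 <= w j, \sum_(j < m) w j = 1,
        forall j i, density (r j i) &
        rho = fun x y => \sum_(j < m) ((w j)%:C)%C * \prod_(i < t) r j i (x i) (y i)].

Definition qcode (k t : nat) (q : 'I_t -> nat)
  (Enc : op (qreg k) -> op (cw q)) (Dec : op (cw q) -> op (qreg k)) : Prop :=
  [/\ CPTP Enc, CPTP Dec & forall X, Dec (Enc X) = X].

Definition nonmalleable (k t : nat) (q : 'I_t -> nat)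
  (Enc : op (qreg k) -> op (cw q)) (Dec : op (cw q) -> op (qreg k)) (eps : R) : Prop :=
  forall Lam, in_LO Lam ->
  exists (p : R) (gam : op (qreg k)),
    [/\ 0 <= p <= 1, density gam &
      forall sigma : op (qreg k), density sigma ->
        trnorm (fun u v =>
          tens_id (fun X => Dec (Lam (Enc X))) (purif sigma) u v
          - ((p%:C)%C * purif sigma u v
             + ((1 - p)%:C)%C * kron gam (ptr1 (purif sigma)) u v)) <= eps].

End Quantum.

(* Main.v *)
(** Some share A holds at least n/t of the n qubits, so the remaining shares B
    have dimension d_B <= 2^k / 16.  Let E_m be the effect "decodes to m".  For
    a product vector a (x) b accepted by E_m with certainty,
    |ab><ab| <= E_m, hence |a><a| <= T_m := Tr_B E_m; as the T_m add up to
    d_B times the identity, share A alone already singles out m among typical messages: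
    the spectral projection P_m of T_m onto eigenvalues >= 1/4 almost
    always accepts the codewords of m and rejects those of most other messages.
    The adversary measures P_m on A, leaves the state alone if it is rejected
    and otherwise replaces A by the maximally mixed state.  This destroys m but
    preserves most other messages, which p sigma + (1 - p) gamma cannot imitate
    up to 1/16.  If n = 1, A is everything and the adversary decodes, negates
    the message and encodes again.  In both cases eps >= 1/16, while
    k <= n forces delta <= 1. *)

From Stdlib Require Import ClassicalEpsilon.
Require Import Defs.
From mathcomp Require Import all_boot all_order all_algebra.
From mathcomp Require Import all_classical all_reals exp realfun.
From mathcomp Require Import complex.
From mathcomp Require Import ring lra.
Import Order.TTheory GRing.Theory Num.Theory.
Local Open Scope ring_scope.

Set Implicit Arguments.
Unset Strict Implicit.
Unset Printing Implicit Defensive.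

(** * Sesquilinear forms and spectral decomposition *)

Section Forms.
Local Open Scope sesquilinear_scope.
Variable C : numClosedFieldType.
Implicit Types I J : finType.

Definition inner I (u v : I -> C) : C := \sum_x (u x)^* * v x.
Definition form I (A : I -> I -> C) (u v : I -> C) : C :=
  \sum_x \sum_y (u x)^* * A x y * v y.
Definition posform I (A : I -> I -> C) := forall v, 0 <= form A v v.
Definition app I J (K : J -> I -> C) (v : I -> C) : J -> C :=
  fun x => \sum_y K x y * v y.

Lemma form_app I (A : I -> I -> C) u v : form A u v = inner u (app A v).
Proof.
apply: eq_bigr => x _; rewrite mulr_sumr.
by apply: eq_bigr => y _; rewrite mulrA.
Qed.

Lemma innerC I (u v : I -> C) : inner v u = (inner u v)^*.
Proof.
rewrite rmorph_sum; apply: eq_bigr => x _.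
by rewrite rmorphM /= conjCK mulrC.
Qed.

Lemma inner_ge0 I (u : I -> C) : 0 <= inner u u.
Proof. by apply: sumr_ge0 => x _; rewrite mulrC -normCK exprn_ge0. Qed.

Lemma form_id I (u v : I -> C) :
  form (fun x y => (x == y)%:R) u v = inner u v.
Proof.
apply: eq_bigr => x _; rewrite (bigD1 x) //= eqxx mulr1 big1 ?addr0 // => y.
by rewrite eq_sym => /negbTE ->; rewrite mulr0 mul0r.
Qed.

Lemma formB I (A B : I -> I -> C) u v :
  form (fun x y => A x y - B x y) u v = form A u v - form B u v.
Proof.
rewrite /form -sumrB; apply: eq_bigr => x _; rewrite -sumrB.
by apply: eq_bigr => y _; ring.
Qed.

Lemma form_comb I (A : I -> I -> C) (a b : C) (u v : I -> C) :
  form A (fun x => a * u x + b * v x) (fun x => a * u x + b * v x) =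
  a^* * a * form A u u + a^* * b * form A u v
  + b^* * a * form A v u + b^* * b * form A v v.
Proof.
rewrite /form !mulr_sumr -!big_split /=; apply: eq_bigr => x _.
rewrite !mulr_sumr -!big_split /=; apply: eq_bigr => y _.
by rewrite !rmorphD !rmorphM /=; ring.
Qed.

Lemma form_delta I (A : I -> I -> C) x y :
  form A (fun z => (z == x)%:R) (fun z => (z == y)%:R) = A x y.
Proof.
rewrite /form (bigD1 x) //= [X in _ + X]big1 ?addr0; last first.
  move=> z /negbTE ->; rewrite big1 // => t _; by rewrite conjC0 !mul0r.
rewrite eqxx conjC1 (bigD1 y) //= eqxx mulr1 mul1r big1 ?addr0 //.
by move=> z /negbTE ->; rewrite mulr0.
Qed.

Lemma posform_diag I (A : I -> I -> C) : posform A -> forall x, 0 <= A x x.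
Proof. by move=> A0 x; rewrite -(form_delta A). Qed.

(* Polarization with the vectors e_x + e_y and e_x + i e_y. *)
Lemma posform_herm I (A : I -> I -> C) :
  posform A -> forall x y, A y x = (A x y)^*.
Proof.
move=> A0 x y.
have real v : (form A v v)^* = form A v v by apply/CrealP/ger0_real.
have := real (fun z => 1 * (z == x)%:R + 1 * (z == y)%:R).
have := real (fun z => 1 * (z == x)%:R + 'i * (z == y)%:R).
have Axx := real (fun z => (z == x)%:R); have Ayy := real (fun z => (z == y)%:R).
rewrite !form_comb !rmorphD !rmorphM /= !form_delta !conjC1 conjCi.
move: Axx Ayy; rewrite !form_delta rmorphN /= !conjCi => -> -> h1 h2.
have e1 : 'i * ((A y x)^* - A x y) = 'i * ((A x y)^* - A y x).
  move: h1; set a := A x x; set b := A y y; move=> h1.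
  have : 'i * ((A y x)^* - A x y) - 'i * ((A x y)^* - A y x) =
    (1 * 1 * a + 1 * - 'i * (A x y)^* + - - 'i * 1 * (A y x)^* + - - 'i * - 'i * b)
    - (1 * 1 * a + 1 * 'i * A x y + - 'i * 1 * A y x + - 'i * 'i * b) by ring.
  by rewrite h1 subrr => /eqP; rewrite subr_eq0 => /eqP.
have {}e1 := mulfI (neq0Ci C) e1.
have e2 : (A x y)^* - A y x = - ((A y x)^* - A x y).
  move: h2; set a := A x x; set b := A y y; move=> h2.
  have : (A x y)^* - A y x - - ((A y x)^* - A x y) =
    (1 * 1 * a + 1 * 1 * (A x y)^* + 1 * 1 * (A y x)^* + 1 * 1 * b)
    - (1 * 1 * a + 1 * 1 * A x y + 1 * 1 * A y x + 1 * 1 * b) by ring.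
  by rewrite h2 subrr => /eqP; rewrite subr_eq0 => /eqP.
have /eqP : (A x y)^* - A y x + ((A x y)^* - A y x) = 0 by rewrite -{1}e1 [X in _ + X]e2 subrr.
by rewrite -mulr2n mulrn_eq0 /= subr_eq0 => /eqP.
Qed.

Lemma form_herm I (A : I -> I -> C) u v :
  posform A -> form A v u = (form A u v)^*.
Proof.
move=> A0; rewrite /form exchange_big rmorph_sum; apply: eq_bigr => x _ /=.
rewrite rmorph_sum; apply: eq_bigr => y _ /=.
by rewrite !rmorphM /= conjCK -(posform_herm A0); ring.
Qed.

(** With b = A(u,v), positivity at A(v,v) u - conj(b) v gives A(v,v) (A(u,u) A(v,v) - |b|^2) >= 0,
    which settles A(v,v) <> 0. The case A(u,u) <> 0 is symmetric. *)
Lemma form_CS I (A : I -> I -> C) u v :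
  posform A -> `|form A u v| ^+ 2 <= form A u u * form A v v.
Proof.
move=> A0; rewrite normCK; set b := form A u v.
have hb : form A v u = b^* by apply: form_herm.
have key : 0 <= form A v v * (form A u u * form A v v - b * b^*).
  have := A0 (fun x => form A v v * u x + (- b^*) * v x).
  rewrite form_comb -/b hb rmorphN /= conjCK.
  have -> : (form A v v)^* = form A v v by apply/CrealP/ger0_real.
  by congr (0 <= _); ring.
have key' : 0 <= form A u u * (form A u u * form A v v - b * b^*).
  have := A0 (fun x => form A u u * v x + (- b) * u x).
  rewrite form_comb -/b hb rmorphN /=.
  have -> : (form A u u)^* = form A u u by apply/CrealP/ger0_real.
  by congr (0 <= _); ring.
rewrite -subr_ge0.
case: (eqVneq (form A v v) 0) => [v0|vn0]; last first.
  by rewrite -(pmulr_rge0 _ (_ : 0 < form A v v)) // lt0r vn0 A0.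
case: (eqVneq (form A u u) 0) => [u0|un0]; last first.
  by rewrite -(pmulr_rge0 _ (_ : 0 < form A u u)) // lt0r un0 A0.
(* Both diagonal values vanish, so the vector u - conj(b) v has value -2 |b|^2, which forces b =
   0. *)
have := A0 (fun x => 1 * u x + (- b^*) * v x).
rewrite form_comb -/b hb v0 u0 rmorphN /= conjCK conjC1.
have -> : 1 * 1 * 0 + 1 * - b^* * b + - b * 1 * b^* + - b * - b^* * 0
  = - (b * b^*) *+ 2 by rewrite mulr2n; ring.
by rewrite pmulrn_lge0 // mul0r sub0r.
Qed.

Lemma inner_CS I (u v : I -> C) :
  `|inner u v| ^+ 2 <= inner u u * inner v v.
Proof.
rewrite -!form_id; apply: form_CS => w.
by rewrite form_id inner_ge0.
Qed.

(** The spectral theorem for normal matrices, transported along [enum_val]. Each eigenvalue is the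
    value of the form at its unit eigenvector, hence nonnegative. *)
Lemma posform_spectral I (A : I -> I -> C) : posform A ->
  exists (d : I -> C) (e : I -> I -> C),
    [/\ forall z, 0 <= d z,
        forall z z', inner (e z) (e z') = (z == z')%:R,
        forall x y, \sum_z e z x * (e z y)^* = (x == y)%:R &
        forall x y, A x y = \sum_z d z * (e z x * (e z y)^*)].
Proof.
move=> A0.
pose M := \matrix_(i, j < #|I|) A (enum_val i) (enum_val j).
have hM : M \is hermsymmx.
  apply/is_hermitianmxP; rewrite expr0 scale1r; apply/matrixP => i j.
  by rewrite !mxE -posform_herm.
have uM := spectral_unitarymx M; have Uu := spectral_unit M.
have /orthomx_spectralP := hermitian_normalmx hM.
set U := spectralmx M in uM Uu *; set s := spectral_diag M; move=> eM.
have vM := invmx_unitary uM; rewrite vM in eM.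
(* From M = U^dagger diag(s) U, the eigenvectors are the conjugated rows of U. *)
pose e z x := (U (enum_rank z) (enum_rank x))^*.
have orth z z' : inner (e z) (e z') = (z == z')%:R.
  have /unitarymxP/matrixP/(_ (enum_rank z) (enum_rank z')) := uM.
  rewrite !mxE (inj_eq enum_rank_inj) => <-.
  rewrite (reindex _ (onW_bij _ (@enum_rank_bij I))); apply: eq_bigr => x _ /=.
  by rewrite !mxE conjCK.
have eA x y : A x y = \sum_z s 0 (enum_rank z) * (e z x * (e z y)^*).
  have /matrixP/(_ (enum_rank x) (enum_rank y)) := eM.
  rewrite [LHS]mxE !enum_rankK => ->; rewrite mxE.
  rewrite (reindex _ (onW_bij _ (@enum_rank_bij I))); apply: eq_bigr => z _ /=.
  rewrite mul_mx_diag !mxE /e conjCK -/s.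
  ring.
exists (fun z => s 0 (enum_rank z)), e; split => // [z|x y].
  suff -> : s 0 (enum_rank z) = form A (e z) (e z) by [].
  rewrite form_app; have ap x : app A (e z) x = s 0 (enum_rank z) * e z x.
    rewrite /app; under eq_bigr => y _ do rewrite eA mulr_suml.
    rewrite exchange_big /=.
    under eq_bigr => z' _ do
      under eq_bigr => y _ do rewrite -!mulrA.
    under eq_bigr => z' _ do rewrite -!mulr_sumr -/(inner _ _) orth.
    rewrite (bigD1 z) //= eqxx mulr1 big1 ?addr0 // => z' /negbTE ->.
    by rewrite !mulr0.
  rewrite /inner; under eq_bigr => x _ do rewrite ap mulrCA.
  by rewrite -mulr_sumr -/(inner _ _) orth eqxx mulr1.
have : U^t* *m U = 1%:M by rewrite -vM mulVmx.
move=> /matrixP/(_ (enum_rank x) (enum_rank y)).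
rewrite !mxE (inj_eq enum_rank_inj) => <-.
rewrite (reindex _ (onW_bij _ (@enum_rank_bij I))); apply: eq_bigr => z _ /=.
by rewrite !mxE /e conjCK.
Qed.

End Forms.

(** * Functional calculus in an orthonormal eigenbasis *)

Section Spectral.
Variable C : numClosedFieldType.
Implicit Types I J : finType.

(** The operator sum_z f(z) |e_z><e_z|: the eigenbasis is fixed while the eigenvalue function
    varies. *)
Definition spec I (e : I -> I -> C) (f : I -> C) : I -> I -> C :=
  fun x y => \sum_z f z * (e z x * (e z y)^*).

Definition orthonormal_basis I (e : I -> I -> C) :=
  (forall z z', inner (e z) (e z') = (z == z')%:R) /\
  (forall x y, \sum_z e z x * (e z y)^* = (x == y)%:R).

Lemma inner_spec I (e : I -> I -> C) f v z : orthonormal_basis e ->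
  inner (e z) (app (spec e f) v) = f z * inner (e z) v.
Proof.
move=> [orth _]; rewrite -form_app /form exchange_big /=.
rewrite [in RHS]/inner mulr_sumr; apply: eq_bigr => y _.
rewrite -mulr_suml mulrA; congr (_ * _).
under eq_bigr => x _ do rewrite mulr_sumr.
rewrite exchange_big /=.
under eq_bigr => w _.
  under eq_bigr => x _.
    rewrite (_ : _ * _ = f w * (e w y)^* * ((e z x)^* * e w x)); last by ring.
  over.
  rewrite -mulr_sumr -/(inner _ _) orth.
over.
rewrite /= (bigD1 z) //= eqxx mulr1 big1 ?addr0 // => w.
by rewrite eq_sym => /negbTE ->; rewrite mulr0.
Qed.

Lemma form_spec I (e : I -> I -> C) f v :
  form (spec e f) v v = \sum_z f z * `|inner (e z) v| ^+ 2.
Proof.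
rewrite /form /spec.
under eq_bigr => x _.
  under eq_bigr => y _ do rewrite mulr_sumr mulr_suml.
  rewrite exchange_big /=.
over.
rewrite /= exchange_big /=; apply: eq_bigr => z _.
rewrite normCK -innerC mulrA {2}/inner mulr_sumr; apply: eq_bigr => x _.
rewrite (mulrC (f z)) -mulrA /inner mulr_suml; apply: eq_bigr => y _.
by ring.
Qed.

Lemma spec_mul I (e : I -> I -> C) f g x y : orthonormal_basis e ->
  \sum_w spec e f x w * spec e g w y = spec e (fun z => f z * g z) x y.
Proof.
move=> [orth _]; rewrite /spec.
under eq_bigr => w _.
  rewrite mulr_suml.
  under eq_bigr => z _ do rewrite mulr_sumr.
over.
rewrite /= exchange_big; apply: eq_bigr => z _ /=.
rewrite exchange_big /=.
under eq_bigr => z' _.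
  under eq_bigr => w _.
    rewrite (_ : _ * _ = f z * g z' * e z x * (e z' y)^* *
       ((e z w)^* * e z' w)); last by ring.
  over.
  rewrite -mulr_sumr -/(inner _ _) orth.
over.
rewrite /= (bigD1 z) //= eqxx mulr1 big1 ?addr0 => [|w]; first by ring.
by rewrite eq_sym => /negbTE ->; rewrite mulr0.
Qed.

Lemma spec1 I (e : I -> I -> C) x y : orthonormal_basis e ->
  spec e (fun=> 1) x y = (x == y)%:R.
Proof. by case=> _ <-; apply: eq_bigr => z _; rewrite mul1r. Qed.

Lemma parseval I (e : I -> I -> C) v : orthonormal_basis e ->
  inner v v = \sum_z `|inner (e z) v| ^+ 2.
Proof.
move=> be; rewrite -form_id.
rewrite (_ : form _ v v = form (spec e (fun=> 1)) v v); last first.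
  by apply: eq_bigr => x _; apply: eq_bigr => y _; rewrite spec1.
by rewrite form_spec; apply: eq_bigr => z _; rewrite mul1r.
Qed.

Lemma spec_ge0 I (e : I -> I -> C) f : (forall z, 0 <= f z) ->
  posform (spec e f).
Proof.
move=> f0 v; rewrite form_spec; apply: sumr_ge0 => z _.
by rewrite mulr_ge0 ?exprn_ge0.
Qed.

Lemma eq_form I (A B : I -> I -> C) u v :
  (forall x y, A x y = B x y) -> form A u v = form B u v.
Proof.
by move=> AB; apply: eq_bigr => x _; apply: eq_bigr => y _; rewrite AB.
Qed.

Lemma posform_specP I (A : I -> I -> C) : posform A ->
  exists d e, [/\ forall z, 0 <= d z, orthonormal_basis e &
    forall x y, A x y = spec e d x y].
Proof. by case/posform_spectral => d [e [d0 e1 e2 eA]]; exists d, e; split. Qed.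

Lemma posform_sqrt I (A : I -> I -> C) : posform A ->
  exists S, posform S /\ forall x y, \sum_z S x z * S z y = A x y.
Proof.
case/posform_specP => d [e [d0 be eA]].
exists (spec e (fun z => sqrtC (d z))); split.
  by apply: spec_ge0 => z; rewrite sqrtC_ge0.
move=> x y; rewrite spec_mul // eA; apply: eq_bigr => z _.
by rewrite -expr2 sqrtCK.
Qed.

(** The eigenvalues are nonnegative with sum the trace, and each weight |<e_z|v>|^2 is at most
    <v|v>. *)
Lemma form_le_trace I (A : I -> I -> C) v : posform A ->
  form A v v <= (\sum_x A x x) * inner v v.
Proof.
case/posform_specP => d [e [d0 be eA]].
rewrite (eq_form _ _ eA) form_spec.
have -> : \sum_x A x x = \sum_z d z.
  under eq_bigr => x _ do rewrite eA.
  rewrite exchange_big; apply: eq_bigr => z _ /=.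
  rewrite -mulr_sumr; under eq_bigr => x _ do rewrite mulrC.
  by case: be => orth _; rewrite -/(inner _ _) orth eqxx mulr1.
rewrite mulr_suml; apply: ler_sum => z _.
apply: ler_wpM2l => //; apply: le_trans (inner_CS _ _) _.
by case: be => orth _; rewrite orth eqxx mul1r.
Qed.

(** P is the spectral projection onto the eigenvalues >= tau. Hence tau P <= A, while compressing A
    to the complement of P leaves at most tau. *)
Lemma threshold_projector I (A : I -> I -> C) tau : posform A -> 0 < tau ->
  exists P : I -> I -> C,
   [/\ forall x y, P y x = (P x y)^*,
       forall x y, \sum_z P x z * P z y = P x y,
       forall v, tau * inner (app P v) (app P v) <= form A v v &
       forall v, form A (app (fun x y => (x == y)%:R - P x y) v)
                        (app (fun x y => (x == y)%:R - P x y) v)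
                 <= tau * inner v v].
Proof.
move=> A0 t0; have [d [e [d0 be eA]]] := posform_specP A0.
pose f z : C := (tau <= d z)%R%:R.
exists (spec e f); split => [x y|x y|v|v].
- rewrite /spec rmorph_sum; apply: eq_bigr => z _ /=.
  by rewrite !rmorphM /= conjCK /f conjC_nat; ring.
- rewrite spec_mul //; apply: eq_bigr => z _.
  by rewrite /f; case: (_ <= _); rewrite ?mul1r ?mul0r.
- rewrite (parseval _ be) (eq_form _ _ eA) form_spec mulr_sumr.
  apply: ler_sum => z _; rewrite inner_spec // normrM exprMn mulrA.
  apply: ler_wpM2r; first by rewrite exprn_ge0.
  rewrite /f; case h: (tau <= d z) => /=; rewrite ?normr1 ?normr0 ?expr1n ?mulr1 //.
  by rewrite expr0n mulr0.
- rewrite (eq_form _ _ eA) form_spec (parseval v be) mulr_sumr.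
  apply: ler_sum => z _.
  have -> : inner (e z) (app (fun x y => (x == y)%:R - spec e f x y) v) =
            (1 - f z) * inner (e z) v.
    rewrite -form_app formB form_id form_app inner_spec //.
    by rewrite mulrBl mul1r.
  rewrite normrM exprMn mulrA.
  apply: ler_wpM2r; first by rewrite exprn_ge0.
  rewrite /f; case h: (tau <= d z) => /=.
    by rewrite subrr normr0 expr0n mulr0 ltW.
  rewrite subr0 normr1 expr1n mulr1 ltW //.
  (* The order on C is partial; [tau] and [d z] are comparable because both are nonnegative, hence
     real. *)
  by rewrite real_ltNge ?h // ger0_real // ltW.
Qed.

End Spectral.

(** * Product vectors and the measure-and-replace attack *)

Section Bipartite.
Variable C : numClosedFieldType.
Implicit Types A B I : finType.

Definition tensv A B (a : A -> C) (b : B -> C) : A * B -> C :=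
  fun x => a x.1 * b x.2.
Definition ptr2 A B (E : A * B -> A * B -> C) : A -> A -> C :=
  fun a a' => \sum_b E (a, b) (a', b).
Definition deltav I (a : I) : I -> C := fun x => (x == a)%:R.

Lemma sum_pair A B (F : A * B -> C) : \sum_p F p = \sum_a \sum_b F (a, b).
Proof. by rewrite pair_bigA; apply: eq_bigr => -[]. Qed.

Lemma sum_const A (c : C) : \sum_(a : A) c = c * #|A|%:R.
Proof. by rewrite sumr_const mulr_natr. Qed.

Lemma eq_formv I (E : I -> I -> C) u u' v v' : u =1 u' -> v =1 v' ->
  form E u v = form E u' v'.
Proof.
move=> uu vv; apply: eq_bigr => x _; apply: eq_bigr => y _.
by rewrite uu vv.
Qed.

Lemma eq_inner I (u u' v v' : I -> C) : u =1 u' -> v =1 v' ->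
  inner u v = inner u' v'.
Proof. by move=> uu vv; apply: eq_bigr => x _; rewrite uu vv. Qed.

Lemma inner_tensv A B (a a' : A -> C) (b b' : B -> C) :
  inner (tensv a b) (tensv a' b') = inner a a' * inner b b'.
Proof.
rewrite /inner sum_pair mulr_suml.
apply: eq_bigr => x _; rewrite mulr_sumr; apply: eq_bigr => y _.
by rewrite /tensv /= rmorphM /=; ring.
Qed.

Lemma form_pair A B (E : A * B -> A * B -> C) u v :
  form E u v = \sum_a \sum_b \sum_a' \sum_b'
     (u (a, b))^* * E (a, b) (a', b') * v (a', b').
Proof.
rewrite /form sum_pair; apply: eq_bigr => a _; apply: eq_bigr => b _.
by rewrite sum_pair.
Qed.

Lemma form_tensv A B (E : A * B -> A * B -> C) a b :
  form E (tensv a b) (tensv a b) =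
  form (fun y y' => form (fun x x' => E (x, y) (x', y')) a a) b b.
Proof.
rewrite form_pair exchange_big [RHS]/form; apply: eq_bigr => y _ /=.
under [RHS]eq_bigr => y' _ do rewrite /form mulr_sumr mulr_suml.
rewrite [RHS]exchange_big; apply: eq_bigr => x _ /=.
rewrite exchange_big; apply: eq_bigr => y' _ /=.
rewrite mulr_sumr mulr_suml; apply: eq_bigr => x' _.
by rewrite /tensv /= rmorphM /=; ring.
Qed.

Lemma form_sum (K I : finType) (A : K -> I -> I -> C) u v :
  form (fun x y => \sum_k A k x y) u v = \sum_k form (A k) u v.
Proof.
rewrite exchange_big /=; apply: eq_bigr => x _.
rewrite exchange_big /=; apply: eq_bigr => y _.
by rewrite mulr_sumr mulr_suml.
Qed.

Lemma form_ptr2 A B (E : A * B -> A * B -> C) u :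
  form (ptr2 E) u u = \sum_b form E (tensv u (deltav b)) (tensv u (deltav b)).
Proof.
rewrite form_sum; apply: eq_bigr => b _.
by rewrite form_tensv form_delta.
Qed.

Lemma posform_ptr2 A B (E : A * B -> A * B -> C) : posform E -> posform (ptr2 E).
Proof. by move=> E0 u; rewrite form_ptr2 sumr_ge0. Qed.

(** For fixed a the left side is a positive form in b, and its trace is <a|Tr_B E|a>. *)
Lemma form_tensv_le A B (E : A * B -> A * B -> C) a b : posform E ->
  form E (tensv a b) (tensv a b) <= form (ptr2 E) a a * inner b b.
Proof.
move=> E0; rewrite form_tensv.
apply: le_trans (form_le_trace _ _) _ => [v|]; first by rewrite -form_tensv.
by rewrite form_sum.
Qed.

(** The sum is <b|Tr_A E|b>, and Tr_A E is positive with trace Tr E. It controls the outcome once A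
    has been replaced by the maximally mixed state. *)
Lemma sum_form_deltal_le A B (E : A * B -> A * B -> C) b : posform E ->
  \sum_a form E (tensv (deltav a) b) (tensv (deltav a) b)
    <= (\sum_x E x x) * inner b b.
Proof.
move=> E0; have -> : \sum_a form E (tensv (deltav a) b) (tensv (deltav a) b)
    = form (fun y y' => \sum_a E (a, y) (a, y')) b b.
  rewrite form_sum; apply: eq_bigr => a _; rewrite form_tensv.
  by apply: eq_form => y y'; rewrite form_delta.
apply: le_trans (form_le_trace _ _) _ => [v|].
  rewrite form_sum sumr_ge0 // => a _.
  rewrite -[X in _ <= X](_ : form E (tensv (deltav a) v) (tensv (deltav a) v) = _).
    exact: E0.
  by rewrite form_tensv; apply: eq_form => y y'; rewrite form_delta.
by rewrite exchange_big /= sum_pair.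
Qed.

(* Kraus operators of the channel that measures the projection [P] and, on
   outcome [P], replaces the system by a maximally mixed state. *)
Definition attack A (P : A -> A -> C) (s : option (A * A)) : A -> A -> C :=
  if s is Some (a, a') then
    fun x y => sqrtC (#|A|%:R^-1) * (x == a)%:R * P a' y
  else fun x y => (x == y)%:R - P x y.

Definition projector A (P : A -> A -> C) :=
  (forall x y, P y x = (P x y)^*) /\
  (forall x y, \sum_z P x z * P z y = P x y).

Definition kraus (S I J : finType) (K : S -> J -> I -> C) :=
  forall x y, \sum_s \sum_z (K s z x)^* * K s z y = (x == y)%:R.

Lemma big_option (S : finType) (F : option S -> C) :
  \sum_s F s = F None + \sum_s F (Some s).
Proof.
rewrite (bigD1 None) //=; congr (_ + _).
rewrite (reindex_omap Some id) /=; last by case.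
by apply: eq_bigl => s; rewrite eqxx.
Qed.

Lemma sqrtC_inv_card A : (0 < #|A|)%N ->
  (sqrtC (#|A|%:R^-1) : C)^* * sqrtC (#|A|%:R^-1) * #|A|%:R = 1.
Proof.
move=> A0; have -> : (sqrtC (#|A|%:R^-1) : C)^* = sqrtC (#|A|%:R^-1).
  by apply/CrealP/ger0_real; rewrite sqrtC_ge0 invr_ge0 ler0n.
by rewrite -expr2 sqrtCK mulVf // pnatr_eq0 -lt0n.
Qed.

Lemma inner_complement A (P : A -> A -> C) v : projector P ->
  let Q := fun x y => (x == y)%:R - P x y in
  [/\ inner (app Q v) (app Q v) = inner v v - inner (app P v) (app P v)
    & inner (app Q v) v = inner (app Q v) (app Q v)].
Proof.
move=> [Ph PP] Q.
have appQ x : app Q v x = v x - app P v x.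
  rewrite /app /Q (eq_bigr (fun y => (x == y)%:R * v y - P x y * v y)); last first.
    by move=> y _; rewrite mulrBl.
  rewrite sumrB (bigD1 x) //= eqxx mul1r [X in _ + X - _]big1 ?addr0 // => y.
  by rewrite eq_sym => /negbTE ->; rewrite mul0r.
have self u w : inner (app P u) w = inner u (app P w).
  rewrite -form_app /inner /form exchange_big /=; apply: eq_bigr => x _.
  rewrite /app rmorph_sum mulr_suml; apply: eq_bigr => y _ /=.
  by rewrite rmorphM /= -Ph mulrAC; ring.
have idem x : app P (app P v) x = app P v x.
  rewrite /app; under eq_bigr => y _ do rewrite mulr_sumr.
  rewrite exchange_big; apply: eq_bigr => y _ /=.
  by rewrite -PP mulr_suml; apply: eq_bigr => z _; rewrite mulrA.
have PPv : inner v (app P v) = inner (app P v) (app P v).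
  by rewrite self; apply: eq_inner => // x; rewrite idem.
have e1 w : inner (app Q v) w = inner v w - inner (app P v) w.
  rewrite /inner -sumrB; apply: eq_bigr => x _.
  by rewrite appQ rmorphB /= mulrBl.
have e2 w : inner w (app Q v) = inner w v - inner w (app P v).
  rewrite /inner -sumrB; apply: eq_bigr => x _.
  by rewrite appQ mulrBr.
have Pv : inner (app P v) v = inner (app P v) (app P v) by rewrite self.
by rewrite !e1 !e2 Pv PPv subrr subr0.
Qed.

(** The branch [None] contributes 1 - P. The branches [Some (a, a')] contribute P, since the squared
    factor 1/|A| cancels the |A| choices of a. *)
Lemma attack_kraus A (P : A -> A -> C) : (0 < #|A|)%N -> projector P ->
  kraus (attack P).
Proof.
move=> A0 [Ph PP] x y; rewrite big_option.
have -> : \sum_z (attack P None z x)^* * attack P None z y = (x == y)%:R - P x y.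
  rewrite /= (eq_bigr (fun z => (z == x)%:R * (z == y)%:R - (z == x)%:R * P z y
     - P x z * (z == y)%:R + P x z * P z y)); last first.
    by move=> z _; rewrite rmorphB /= conjC_nat -(Ph z x); ring.
  rewrite big_split /= PP !sumrB.
  rewrite (bigD1 x) //= eqxx mul1r big1 ?addr0; last first.
    by move=> z /negbTE ->; rewrite mul0r.
  rewrite (bigD1 x) //= eqxx mul1r big1 ?addr0; last first.
    by move=> z /negbTE ->; rewrite mul0r.
  rewrite (bigD1 y) //= eqxx mulr1 big1 ?addr0; last first.
    by move=> z /negbTE ->; rewrite mulr0.
  by ring.
have -> : \sum_s \sum_z (attack P (Some s) z x)^* * attack P (Some s) z y = P x y.
  rewrite sum_pair /=.
  rewrite (eq_bigr (fun a : A => (sqrtC (#|A|%:R^-1) : C)^* * sqrtC (#|A|%:R^-1)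
     * P x y)); last first.
    move=> a _; rewrite -PP mulr_sumr; apply: eq_bigr => a' _.
    rewrite (bigD1 a) //= eqxx big1 ?addr0 => [|z /negbTE -> /=]; last first.
      by rewrite !(mulr0, mul0r).
    by rewrite !rmorphM /= conjC1 -(Ph a' x) !mulr1 mulrACA.
  by rewrite sum_const mulrAC (sqrtC_inv_card A0) mul1r.
by rewrite subrK.
Qed.

(* Probability that the effect [E] occurs on the state
   [\sum_r w r |alpha_r (x) beta_r><alpha_r (x) beta_r|]
   once the Kraus operators [K] have acted on the first factor. *)
Definition outcome A B (S R : finType) (E : A * B -> A * B -> C)
    (K : S -> A -> A -> C) (w : R -> C) (alpha : R -> A -> C)
    (beta : R -> B -> C) : C :=
  \sum_r w r * \sum_s form E (tensv (app (K s) (alpha r)) (beta r))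
                             (tensv (app (K s) (alpha r)) (beta r)).

Lemma form_tensvZ A B (E : A * B -> A * B -> C) (c : C) a b :
  form E (tensv (fun x => c * a x) b) (tensv (fun x => c * a x) b) =
  `|c| ^+ 2 * form E (tensv a b) (tensv a b).
Proof.
rewrite normCK /form mulr_sumr; apply: eq_bigr => x _; rewrite mulr_sumr.
by apply: eq_bigr => y _; rewrite /tensv !rmorphM /=; ring.
Qed.

(** The branch [Some (a, a')] sends v to the basis vector at a times |A|^(-1/2) (P v)(a'). Summing
    the squared coefficients over a' produces <Pv|Pv>/|A|. *)
Lemma sum_form_attack A B (E : A * B -> A * B -> C) P v b : (0 < #|A|)%N ->
  \sum_s form E (tensv (app (attack P s) v) b) (tensv (app (attack P s) v) b)
  = form E (tensv (app (fun x y => (x == y)%:R - P x y) v) b)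
           (tensv (app (fun x y => (x == y)%:R - P x y) v) b)
   + #|A|%:R^-1 * inner (app P v) (app P v) *
      \sum_a form E (tensv (deltav a) b) (tensv (deltav a) b).
Proof.
move=> A0; rewrite big_option; congr (_ + _).
rewrite sum_pair mulr_sumr; apply: eq_bigr => a _.
rewrite [X in _ * X * _]/inner [X in _ = X * _]mulr_sumr mulr_suml; apply: eq_bigr => a' _.
have hv : tensv (app (attack P (Some (a, a'))) v) b =1
    tensv (fun x => (sqrtC (#|A|%:R^-1) * app P v a') * deltav a x) b.
  move=> x; rewrite /tensv /app /deltav; congr (_ * _).
  by rewrite mulr_sumr mulr_suml; apply: eq_bigr => y _ /=; ring.
rewrite (eq_formv _ hv hv) form_tensvZ normrM exprMn; congr (_ * _).
have -> : `|sqrtC (#|A|%:R^-1) : C| ^+ 2 = #|A|%:R^-1.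
  by rewrite -normrX sqrtCK ger0_norm // invr_ge0 ler0n.
by rewrite normCK mulrC (mulrC (_^*)) mulrC.
Qed.

(** The attack on m destroys m. A vector that P rejects lies where Tr_B E is at most tau, so E
    accepts it with probability at most tau; the replaced state is accepted with probability at most
    Tr E / |A|. *)
Lemma outcome_attack_le A B (R : finType) (E : A * B -> A * B -> C) P tau
    (w : R -> C) (alpha : R -> A -> C) (beta : R -> B -> C) :
  (0 < #|A|)%N -> posform E -> projector P ->
  (forall v, form (ptr2 E) (app (fun x y => (x == y)%:R - P x y) v)
       (app (fun x y => (x == y)%:R - P x y) v) <= tau * inner v v) ->
  (forall r, 0 <= w r) ->
  \sum_r w r * (inner (alpha r) (alpha r) * inner (beta r) (beta r)) = 1 ->
  outcome E (attack P) w alpha beta <= tau + (\sum_x E x x) / #|A|%:R.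
Proof.
move=> A0 E0 projP Pt w0 w1; rewrite -[leRHS]mulr1 -[X in _ <= _ * X]w1 mulr_sumr.
apply: ler_sum => r _; rewrite [leRHS]mulrCA; apply: ler_wpM2l => //.
rewrite sum_form_attack // mulrDl; apply: lerD.
  apply: le_trans (form_tensv_le _ _ E0) _.
  by rewrite mulrA ler_wpM2r ?inner_ge0.
have Pa : inner (app P (alpha r)) (app P (alpha r)) <= inner (alpha r) (alpha r).
  rewrite -subr_ge0; case: (inner_complement (alpha r) projP) => <- _.
  exact: inner_ge0.
rewrite (_ : _ / _ * _ = #|A|%:R^-1 * inner (alpha r) (alpha r) *
  ((\sum_x E x x) * inner (beta r) (beta r))); last by ring.
apply: ler_pM; rewrite ?sum_form_deltal_le //.
- by rewrite mulr_ge0 ?invr_ge0 ?ler0n ?inner_ge0.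
- by apply: sumr_ge0 => a _; apply: E0.
- by rewrite ler_wpM2l ?invr_ge0 ?ler0n.
Qed.

(* A vector accepted with certainty by an effect [E <= 1] satisfies
   [E v = v], hence [|v><v| / <v|v> <= E]. *)
Lemma certain_effect I (E : I -> I -> C) u v : posform E ->
  (forall v, form E v v <= inner v v) -> form E v v = inner v v ->
  `|inner u v| ^+ 2 <= form E u u * inner v v.
Proof.
move=> E0 E1 Ev.
have E'0 : posform (fun x y => (x == y)%:R - E x y).
  by move=> z; rewrite formB form_id subr_ge0.
(* Cauchy-Schwarz for 1 - E, whose value at v is 0, gives <u|v> = <u|E v>. *)
have := form_CS u v E'0; rewrite !formB !form_id Ev subrr mulr0 => h.
have e : inner u v = form E u v.
  have : `|inner u v - form E u v| ^+ 2 == 0 by rewrite eq_le h exprn_ge0.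
  by rewrite expf_eq0 normr_eq0 subr_eq0 => /eqP.
by rewrite e -Ev; apply: form_CS.
Qed.

(** A codeword on which P has small weight survives. Let a, b, p be the squared norms of alpha,
    beta, P alpha, and f the value of E at (1 - P) alpha (x) beta. By [certain_effect], f a b >= ((a
    - p) b)^2, so f >= ab - 2pb; the replacement branch only adds to f. *)
Lemma outcome_attack_ge A B (R : finType) (E : A * B -> A * B -> C) P
    (w : R -> C) (alpha : R -> A -> C) (beta : R -> B -> C) :
  (0 < #|A|)%N -> posform E -> (forall v, form E v v <= inner v v) ->
  projector P -> (forall r, 0 <= w r) ->
  \sum_r w r * (inner (alpha r) (alpha r) * inner (beta r) (beta r)) = 1 ->
  \sum_r w r * form E (tensv (alpha r) (beta r)) (tensv (alpha r) (beta r)) = 1 ->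
  1 - 2 * \sum_r w r * (inner (app P (alpha r)) (app P (alpha r))
                        * inner (beta r) (beta r))
   <= outcome E (attack P) w alpha beta.
Proof.
move=> A0 E0 E1 projP w0 w1 wE.
(* Total weight and total acceptance are both 1, so the nonnegative deficits sum to 0 and each
   component of nonzero weight is accepted with certainty. *)
have tight r : w r != 0 ->
    form E (tensv (alpha r) (beta r)) (tensv (alpha r) (beta r)) =
    inner (tensv (alpha r) (beta r)) (tensv (alpha r) (beta r)).
  move=> wr; have : \sum_r w r * (inner (tensv (alpha r) (beta r))
      (tensv (alpha r) (beta r)) -
      form E (tensv (alpha r) (beta r)) (tensv (alpha r) (beta r))) = 0.
    under eq_bigr => r' _ do rewrite mulrBr inner_tensv.
    by rewrite sumrB w1 wE subrr.
  move/eqP; rewrite psumr_eq0 => [/allP/(_ r)|r' _]; last first.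
    by rewrite mulr_ge0 ?subr_ge0.
  rewrite mem_index_enum => /(_ isT) /=.
  by rewrite mulf_eq0 (negbTE wr) subr_eq0 /= => /eqP.
rewrite -[X in X - _]w1 mulr_sumr -sumrB; apply: ler_sum => r _.
case: (eqVneq (w r) 0) => [->|wr]; first by rewrite !mul0r mulr0 subrr.
rewrite [X in _ - X]mulrCA -mulrBr; apply: ler_wpM2l => //.
rewrite sum_form_attack //.
set f := form E _ _; set X := _^-1 * _ * _.
have X0 : 0 <= X.
  apply: mulr_ge0; first by rewrite mulr_ge0 ?invr_ge0 ?ler0n ?inner_ge0.
  by apply: sumr_ge0 => a _; apply: E0.
apply: le_trans (_ : f <= _); last by rewrite lerDl.
have := certain_effect (tensv (app (fun x y => (x == y)%:R - P x y) (alpha r)) (beta r))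
  E0 E1 (tight _ wr).
rewrite -/f !inner_tensv.
case: (inner_complement (alpha r) projP) => -> ->; rewrite -/f.
have := inner_ge0 (alpha r); have := inner_ge0 (beta r).
have := inner_ge0 (app P (alpha r)).
set a := inner (alpha r) _; set b := inner (beta r) _; set p := inner (app P _) _.
move=> p0 b0 a0.
have ab0 : 0 <= a * b by rewrite mulr_ge0.
have pb0 : 0 <= p * b by rewrite mulr_ge0.
have -> : `|((a - p) * b)| ^+ 2 = ((a - p) * b) ^+ 2.
  by rewrite real_normK // rpredM ?rpredB ?ger0_real.
move=> h; have f0 : 0 <= f by apply: E0.
case: (eqVneq (a * b) 0) => [->|abn].
  by apply: le_trans f0; rewrite sub0r oppr_le0 mulr_ge0.
have abp : 0 < a * b by rewrite lt0r abn.
rewrite -subr_ge0 -(pmulr_rge0 _ abp).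
(* Multiplied by ab, the claim becomes the inequality from [certain_effect] plus the square of
   pb. *)
have -> : a * b * (f - (a * b - 2 * (p * b))) =
  (f * (a * b) - ((a - p) * b) ^+ 2) + (p * b) ^+ 2 by ring.
by rewrite addr_ge0 ?subr_ge0 ?exprn_ge0.
Qed.

(** Here tau P_m <= Tr_B E_m, and the operators Tr_B E_m add up to |B| times the identity. So on
    average over m a fixed state gives P_m little weight. *)
Lemma sum_projector_le A B (M R : finType) (E : M -> A * B -> A * B -> C)
    (P : M -> A -> A -> C) tau
    (w : R -> C) (alpha : R -> A -> C) (beta : R -> B -> C) :
  (forall x y, \sum_m E m x y = (x == y)%:R) ->
  (forall m v, tau * inner (app (P m) v) (app (P m) v) <= form (ptr2 (E m)) v v) ->
  (forall r, 0 <= w r) ->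
  \sum_r w r * (inner (alpha r) (alpha r) * inner (beta r) (beta r)) = 1 ->
  tau * \sum_m \sum_r w r * (inner (app (P m) (alpha r)) (app (P m) (alpha r))
                        * inner (beta r) (beta r)) <= #|B|%:R.
Proof.
move=> E1 Pt w0 w1; rewrite -[leRHS]mulr1 -[X in _ <= _ * X]w1 exchange_big /= !mulr_sumr.
apply: ler_sum => r _; rewrite -mulr_sumr [leLHS]mulrCA [leRHS]mulrCA.
apply: ler_wpM2l => //; rewrite -mulr_suml !mulrA.
apply: ler_wpM2r; first exact: inner_ge0.
rewrite mulr_sumr; apply: le_trans (_ : \sum_m form (ptr2 (E m)) (alpha r) (alpha r) <= _).
  by apply: ler_sum => m _; apply: Pt.
rewrite -form_sum le_eqVlt; apply/orP; left; apply/eqP.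
rewrite -form_id /form mulr_sumr; apply: eq_bigr => x _.
rewrite mulr_sumr; apply: eq_bigr => y _.
rewrite /ptr2 exchange_big /=; under eq_bigr => b _ do rewrite E1 xpair_eqE eqxx andbT.
by rewrite sum_const; ring.
Qed.

End Bipartite.

(** * Channels, effects and the trace norm *)

Section Channels.
Variable R : realType.
Local Notation C := (R[i]).
Implicit Types I J K : finType.

Lemma opP I (X Y : op R I) : (forall x y, X x y = Y x y) -> X = Y.
Proof. by move=> XY; apply: funext => x; apply: funext => y. Qed.

(** [psd_sqrt] is a choice operator, so its properties follow from the existence of a positive
    root. *)
Lemma psd_sqrtP I (A : op R I) : psd A ->
  psd (psd_sqrt A) /\ opmul (psd_sqrt A) (psd_sqrt A) = A.
Proof.
move=> A0; rewrite /psd_sqrt.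
apply: (epsilon_spec (inhabits _) (fun P : op R I => psd P /\ opmul P P = A)).
have [S [S0 SS]] := posform_sqrt A0.
by exists S; split => //; apply: opP.
Qed.

Lemma psd_adj_mul I (Z : op R I) : psd (opmul (adj Z) Z).
Proof.
move=> v; suff -> : \sum_x \sum_y (v x)^* * opmul (adj Z) Z x y * v y =
    inner (app Z v) (app Z v) by exact: inner_ge0.
rewrite /inner.
under [RHS]eq_bigr => z _ do rewrite /app rmorph_sum mulr_suml.
rewrite [RHS]exchange_big; apply: eq_bigr => x _ /=.
under [RHS]eq_bigr => z _ do rewrite mulr_sumr.
rewrite [RHS]exchange_big; apply: eq_bigr => y _ /=.
rewrite /opmul mulr_sumr mulr_suml; apply: eq_bigr => z _.
by rewrite /adj rmorphM /=; ring.
Qed.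

Lemma square_herm I (S : op R I) x : psd S ->
  opmul S S x x = \sum_z `|S x z| ^+ 2.
Proof.
by move=> S0; apply: eq_bigr => z _; rewrite normCK -(posform_herm S0).
Qed.

(** With S = |Z|: |Z_uu|^2 <= (Z^dagger Z)_uu = (S^2)_uu = sum_z |S_uz|^2 <= S_uu Tr S <= (Tr S)^2,
    using |S_uz|^2 <= S_uu S_zz. *)
Lemma trnorm_ge_diag I (Z : op R I) u : `|complex.Re (Z u u)| <= trnorm Z.
Proof.
have [S0 SS] := psd_sqrtP (psd_adj_mul Z).
rewrite /trnorm; set S := psd_sqrt _ in S0 SS *.
have Sd x : 0 <= S x x := posform_diag S0 x.
have tr0 : 0 <= trace S by apply: sumr_ge0.
have Suu : S u u <= trace S.
  by rewrite /trace (bigD1 u) //= lerDl sumr_ge0.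
have Zu : `|Z u u| <= trace S.
  rewrite -(ler_pXn2r (n := 2)) ?nnegrE //.
  apply: le_trans (_ : opmul S S u u <= _).
    rewrite SS /opmul (bigD1 u) //= /adj mulrC -normCK lerDl.
    by apply: sumr_ge0 => z _; rewrite mulrC -normCK exprn_ge0.
  rewrite square_herm // (@le_trans _ _ (S u u * trace S)) //.
    rewrite /trace mulr_sumr; apply: ler_sum => z _.
    by have := form_CS (deltav C u) (deltav C z) S0; rewrite !form_delta.
  by rewrite expr2 ler_wpM2r.
have := le_trans (normc_ge_Re (Z u u)) Zu.
by rewrite -(RRe_real (ger0_real tr0)) lecR.
Qed.

Lemma is_linear_sum I J K (Phi : op R I -> op R J) (c : K -> C) (X : K -> op R I) :
  is_linear Phi ->
  Phi (fun x y => \sum_k c k * X k x y) = fun x y => \sum_k c k * Phi (X k) x y.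
Proof.
move=> lin; elim: (index_enum K) => [|k r IH].
  (* The empty sum: linearity with scalar -1 at X = Y = 0 yields Phi 0 = 0. *)
  have := lin (-1) (fun _ _ => 0) (fun _ _ => 0).
  have -> : (fun x y : I => \sum_(k <- [::]) c k * X k x y) = (fun _ _ => 0).
    by apply: opP => x y; rewrite big_nil.
  have -> : (fun x y : I => -1 * 0 + 0 : C) = (fun _ _ => 0).
    by apply: opP => x y; rewrite mulr0 addr0.
  move=> ->; apply: opP => x y; rewrite big_nil.
  by rewrite mulN1r addNr.
have -> : (fun x y => \sum_(j <- k :: r) c j * X j x y) =
  (fun x y => c k * X k x y + \sum_(j <- r) c j * X j x y).
  by apply: opP => x y; rewrite big_cons.
by rewrite lin IH; apply: opP => x y; rewrite big_cons.
Qed.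

Lemma is_linear_expand I J (Phi : op R I -> op R J) X u v : is_linear Phi ->
  Phi X u v = \sum_a \sum_b X a b * Phi (eunit R a b) u v.
Proof.
move=> lin.
have {1}-> : X = fun x y => \sum_p X p.1 p.2 * eunit R p.1 p.2 x y.
  apply: opP => x y; rewrite (bigD1 (x, y)) //= /eunit !eqxx mulr1 big1 ?addr0 //.
  move=> [a b]; rewrite xpair_eqE /= (eq_sym a) (eq_sym b) => /negbTE ->.
  by rewrite mulr0.
by rewrite (is_linear_sum _ _ lin) sum_pair.
Qed.

(** Complete positivity is applied with a one-dimensional ancilla. *)
Lemma completely_positive_psd I J (Phi : op R I -> op R J) X :
  is_linear Phi -> completely_positive Phi -> psd X -> psd (Phi X).
Proof.
move=> lin cp X0 v.
pose X' : op R (I * 'I_1)%type := fun u v => X u.1 v.1.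
have X'0 : psd X'.
  move=> w; have := X0 (fun x => w (x, ord0)).
  congr (_ <= _); rewrite sum_pair; apply: eq_bigr => x _.
  by rewrite big_ord1 sum_pair; apply: eq_bigr => y _; rewrite big_ord1.
have := cp _ _ X'0 (fun u => v u.1); congr (_ <= _).
rewrite sum_pair; apply: eq_bigr => x _.
rewrite big_ord1 sum_pair; apply: eq_bigr => y _; rewrite big_ord1 /=.
by rewrite (is_linear_expand _ _ _ lin).
Qed.

(* The arguments are swapped so that [<m|Dec(X)|m> = tr (effect Dec m X)]. *)
Definition effect I J (Dec : op R I -> op R J) (m : J) : I -> I -> C :=
  fun x y => Dec (eunit R y x) m m.

Lemma effect_mixture I J K (Dec : op R I -> op R J) (w : K -> C) (v : K -> I -> C) m :
  is_linear Dec ->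
  Dec (fun x y => \sum_k w k * (v k x * (v k y)^*)) m m =
  \sum_k w k * form (effect Dec m) (v k) (v k).
Proof.
move=> lin; rewrite (is_linear_sum _ (fun k x y => v k x * (v k y)^*) lin).
apply: eq_bigr => k _; congr (_ * _); rewrite (is_linear_expand _ _ _ lin).
rewrite exchange_big; apply: eq_bigr => x _; apply: eq_bigr => y _ /=.
by rewrite /effect; ring.
Qed.

(** The value at v is the diagonal entry at m of Dec(|v><v|), a positive operator. *)
Lemma effect_posform I J (Dec : op R I -> op R J) m :
  CPTP Dec -> posform (effect Dec m).
Proof.
move=> [lin cp _] v.
pose X : op R I := fun x y => \sum_(k : unit) 1 * (v x * (v y)^*).
have -> : form (effect Dec m) v v = Dec X m m.
  by rewrite (effect_mixture (fun=> 1) (fun=> v) _ lin) big_const card_unit /= mul1r addr0.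
apply: posform_diag; apply: (completely_positive_psd lin cp) => u.
have -> : \sum_x \sum_y (u x)^* * X x y * u y = inner u v * (inner u v)^*.
  rewrite -innerC /inner mulr_suml; apply: eq_bigr => x _.
  rewrite mulr_sumr; apply: eq_bigr => y _.
  by rewrite /X big_const card_unit /=; ring.
by rewrite -normCK exprn_ge0.
Qed.

Lemma trace_eunit I (x y : I) : trace (eunit R y x) = (x == y)%:R.
Proof.
rewrite /trace /eunit (bigD1 x) //= eqxx andbT big1 ?addr0 // => z /negbTE ->.
by rewrite andbF.
Qed.

Lemma sum_effect I J (Dec : op R I -> op R J) x y : CPTP Dec ->
  \sum_m effect Dec m x y = (x == y)%:R.
Proof. by move=> [_ _ tp]; rewrite -trace_eunit -tp. Qed.

Lemma effect_le1 I J (Dec : op R I -> op R J) m v : CPTP Dec ->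
  form (effect Dec m) v v <= inner v v.
Proof.
move=> D; rewrite -form_id.
have -> : form (fun x y => (x == y)%:R) v v = \sum_m form (effect Dec m) v v.
  by rewrite -form_sum; apply: eq_form => x y; rewrite sum_effect.
by rewrite (bigD1 m) //= lerDl sumr_ge0 // => m' _; apply: effect_posform.
Qed.

Lemma eunit_psd I (m : I) : psd (eunit R m m).
Proof.
move=> v; have -> : \sum_x \sum_y (v x)^* * eunit R m m x y * v y = (v m)^* * v m.
  rewrite (bigD1 m) //= [X in _ + X]big1 ?addr0 => [|x /negbTE xm]; last first.
    by rewrite big1 // => y _; rewrite /eunit xm mulr0 mul0r.
  rewrite (bigD1 m) //= big1 ?addr0 => [|y /negbTE ym].
    by rewrite /eunit eqxx mulr1.
  by rewrite /eunit ym andbF mulr0 mul0r.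
by rewrite mulrC -normCK exprn_ge0.
Qed.

Lemma eunit_density I (m : I) : density (eunit R m m).
Proof. by split; [exact: eunit_psd | rewrite trace_eunit eqxx]. Qed.

(** The chosen root S has to be identified. Row x of S has squared norm (S^2)_xx, so all rows but m
    vanish, by hermiticity all columns but m too, and S_mm >= 0 squares to 1. *)
Lemma psd_sqrt_eunit I (m : I) : psd_sqrt (eunit R m m) = eunit R m m.
Proof.
have [S0 SS] := psd_sqrtP (eunit_psd m); set S := psd_sqrt _ in S0 SS *.
have zero x y : x != m -> S x y = 0.
  move=> xm; have := square_herm x S0; rewrite SS /eunit (negbTE xm) /= => /esym/eqP.
  rewrite psumr_eq0 => [/allP/(_ y)|z _]; last exact: exprn_ge0.
  by rewrite mem_index_enum => /(_ isT) /=; rewrite expf_eq0 normr_eq0 => /eqP.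
apply: opP => x y; rewrite /eunit.
case: (eqVneq x m) => [->|/zero ->] //=.
case: (eqVneq y m) => [->|/zero ym] /=; last by rewrite (posform_herm S0 y) ym conjC0.
have := square_herm m S0; rewrite SS /eunit eqxx /= (bigD1 m) //= big1 ?addr0.
  rewrite ger0_norm ?posform_diag // => /esym/eqP.
  by rewrite sqrf_eq1 => /orP[/eqP //|/eqP e]; have := posform_diag S0 m; rewrite e ler0N1.
by move=> z /zero zm; rewrite (posform_herm S0 z) zm conjC0 normr0 expr0n.
Qed.

(** Reduces non-malleability to classical probabilities: for a basis message m the purification is
    |m>|m>, and the trace norm dominates the diagonal entry at (m', m). The same p and gamma serve
    all messages. *)
Lemma nonmalleable_diag k t (q : 'I_t -> nat) (Enc : op R (qreg k) -> op R (cw q))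
    (Dec : op R (cw q) -> op R (qreg k)) eps Lam :
  nonmalleable Enc Dec eps -> in_LO Lam ->
  exists (p : R) (gam : qreg k -> R),
    [/\ 0 <= p <= 1, forall m, 0 <= gam m, \sum_m gam m = 1 &
      forall m m', `|complex.Re (Dec (Lam (Enc (eunit R m m))) m' m')
         - (p * (m' == m)%:R + (1 - p) * gam m')| <= eps].
Proof.
move=> nm /nm [p [g [p01 [g0 g1] H]]].
have gR m : (complex.Re (g m m))%:C%C = g m m.
  by apply: RRe_real; apply: ger0_real; apply: posform_diag.
exists p, (fun m => complex.Re (g m m)); split => //.
- by move=> m; rewrite -lecR gR; apply: posform_diag.
- apply: (@complexI R); rewrite rmorph_sum rmorph1 -[RHS]g1 /=.
  by apply: eq_bigr => m _; rewrite gR.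
move=> m m'; apply: le_trans (H _ (eunit_density m)).
apply: le_trans (trnorm_ge_diag _ (m', m)); rewrite /=.
have pur a b c d : purif (eunit R m m) (a, b) (c, d) =
   ((a == m) && (b == m))%:R * ((c == m) && (d == m))%:R.
  by rewrite /purif psd_sqrt_eunit /eunit conjC_nat.
rewrite le_eqVlt; apply/orP; left; apply/eqP; congr (`| _ |).
have -> : tens_id (fun X => Dec (Lam (Enc X))) (purif (eunit R m m)) (m', m) (m', m)
  = Dec (Lam (Enc (eunit R m m))) m' m'.
  rewrite /tens_id /= (bigD1 m) //= [X in _ + X]big1 ?addr0 => [|a /negbTE am]; last first.
    by rewrite big1 // => b _; rewrite pur am /= !mul0r.
  rewrite (bigD1 m) //= big1 ?addr0 => [|a /negbTE am].
    by rewrite pur eqxx !mul1r.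
  by rewrite pur am /= mulr0 mul0r.
have -> : purif (eunit R m m) (m', m) (m', m) = ((m' == m)%:R%:C)%C.
  by rewrite pur eqxx andbT; case: (m' == m); rewrite ?mul1r ?mul0r.
have -> : kron g (ptr1 (purif (eunit R m m))) (m', m) (m', m)
   = ((complex.Re (g m' m'))%:C)%C.
  rewrite gR /kron /ptr1 /= (bigD1 m) //= big1 ?addr0 => [|a /negbTE am].
    by rewrite pur eqxx !mulr1.
  by rewrite pur am mul0r.
by rewrite -!rmorphM -rmorphD raddfB.
Qed.

(** * Channels given by Kraus operators *)

Definition kraus_map (S I J : finType) (K : S -> J -> I -> C) : op R I -> op R J :=
  fun X x y => \sum_s \sum_a \sum_b K s x a * X a b * (K s y b)^*.

Lemma kraus_map_eunit (S I J : finType) (K : S -> J -> I -> C) a b x y :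
  kraus_map K (eunit R a b) x y = \sum_s K s x a * (K s y b)^*.
Proof.
apply: eq_bigr => s _.
rewrite (bigD1 a) //= [X in _ + X]big1 ?addr0 => [|c /negbTE ca]; last first.
  by rewrite big1 // => d _; rewrite /eunit ca mulr0 mul0r.
rewrite (bigD1 b) //= big1 ?addr0 => [|d /negbTE db].
  by rewrite /eunit !eqxx mulr1.
by rewrite /eunit db andbF mulr0 mul0r.
Qed.

Lemma kraus_map_linear (S I J : finType) (K : S -> J -> I -> C) :
  is_linear (kraus_map K).
Proof.
move=> c X Y; apply: opP => x y; rewrite /kraus_map mulr_sumr -big_split.
apply: eq_bigr => s _ /=; rewrite mulr_sumr -big_split.
apply: eq_bigr => a _ /=; rewrite mulr_sumr -big_split.
by apply: eq_bigr => b _ /=; ring.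
Qed.

Lemma kraus_map_psd (S I J : finType) (K : S -> J -> I -> C) X :
  psd X -> psd (kraus_map K X).
Proof.
move=> X0 v.
suff -> : \sum_x \sum_y (v x)^* * kraus_map K X x y * v y =
    \sum_s form X (fun a => \sum_x (K s x a)^* * v x)
                  (fun a => \sum_x (K s x a)^* * v x).
  by apply: sumr_ge0 => s _; apply: X0.
under eq_bigr => x _.
  under eq_bigr => y _ do rewrite /kraus_map mulr_sumr mulr_suml.
  rewrite exchange_big /=.
over.
rewrite /= exchange_big; apply: eq_bigr => s _ /=.
under eq_bigr => x _.
  under eq_bigr => y _ do rewrite mulr_sumr mulr_suml.
  rewrite exchange_big /=.
over.
rewrite /= exchange_big; apply: eq_bigr => a _ /=.
under eq_bigr => x _.
  under eq_bigr => y _ do rewrite mulr_sumr mulr_suml.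
  rewrite exchange_big /=.
over.
rewrite /= exchange_big; apply: eq_bigr => b _ /=.
rewrite mulr_sumr exchange_big; apply: eq_bigr => y _ /=.
rewrite rmorph_sum !mulr_suml; apply: eq_bigr => x _.
by rewrite rmorphM /= conjCK; ring.
Qed.

(** Tensoring with the identity gives again a Kraus map, with operators K_s (x) 1, so complete
    positivity follows from positivity. *)
Lemma tens_id_kraus_map (S I J L : finType) (K : S -> J -> I -> C) X :
  tens_id (kraus_map K) X =
  kraus_map (fun s (x : J * L) (a : I * L) => K s x.1 a.1 * (x.2 == a.2)%:R) X.
Proof.
apply: opP => -[x l] [y l']; rewrite /tens_id /kraus_map /=.
under eq_bigr => a _ do
  under eq_bigr => b _ do rewrite -/(kraus_map K _ _ _) kraus_map_eunit mulr_sumr.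
under eq_bigr => a _ do rewrite exchange_big /=.
rewrite exchange_big; apply: eq_bigr => s _ /=.
rewrite sum_pair; apply: eq_bigr => a _ /=.
rewrite [RHS](bigD1 l) //= [X in _ = _ + X]big1 ?addr0; last first.
  move=> l0; rewrite eq_sym => /negbTE ll; rewrite big1 // => b _.
  by rewrite ll mulr0 !mul0r.
rewrite [RHS]sum_pair; apply: eq_bigr => b _ /=.
rewrite [RHS](bigD1 l') //= [X in _ = _ + X]big1 ?addr0.
  by rewrite !eqxx !mulr1; ring.
by move=> l0; rewrite eq_sym => /negbTE ->; rewrite mulr0 conjC0 mulr0.
Qed.

Lemma kraus_map_CPTP (S I J : finType) (K : S -> J -> I -> C) :
  kraus K -> CPTP (kraus_map K).
Proof.
move=> K1; split; first exact: kraus_map_linear.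
  by move=> n X X0; rewrite tens_id_kraus_map; apply: kraus_map_psd.
move=> X; rewrite /trace /kraus_map.
rewrite exchange_big /=.
under eq_bigr => s _.
  rewrite exchange_big /=.
  under eq_bigr => a _ do rewrite exchange_big /=.
over.
rewrite /= exchange_big; apply: eq_bigr => a _ /=.
rewrite exchange_big (bigD1 a) //= [X in _ + X]big1 ?addr0 => [|b /negbTE ba].
  under eq_bigr => s _.
    under eq_bigr => x _ do rewrite mulrC mulrA.
    rewrite -mulr_suml.
  over.
  by rewrite -mulr_suml K1 eqxx mul1r.
under eq_bigr => s _.
  under eq_bigr => x _ do rewrite mulrC mulrA.
  rewrite -mulr_suml.
over.
by rewrite -mulr_suml K1 ba mul0r.
Qed.

Lemma tens_id_comp I J K (L : finType) (Phi : op R J -> op R K) (Psi : op R I -> op R J) :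
  is_linear Phi -> forall X : op R (I * L)%type,
  tens_id (fun Y => Phi (Psi Y)) X = tens_id Phi (tens_id Psi X).
Proof.
move=> lin X; apply: opP => u v; rewrite /tens_id.
under [RHS]eq_bigr => a _.
  under eq_bigr => b _ do rewrite mulr_suml.
  rewrite exchange_big /=.
over.
rewrite [RHS]exchange_big; apply: eq_bigr => c _ /=.
under [RHS]eq_bigr => a _.
  under eq_bigr => b _ do rewrite mulr_suml.
  rewrite exchange_big /=.
over.
rewrite [RHS]exchange_big; apply: eq_bigr => d _ /=.
rewrite (is_linear_expand _ _ _ lin) mulr_sumr; apply: eq_bigr => a _.
by rewrite mulr_sumr; apply: eq_bigr => b _; rewrite mulrA.
Qed.

Lemma CPTP_comp I J K (Phi : op R J -> op R K) (Psi : op R I -> op R J) :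
  CPTP Phi -> CPTP Psi -> CPTP (fun X => Phi (Psi X)).
Proof.
move=> [l1 c1 t1] [l2 c2 t2]; split.
- by move=> a X Y; rewrite l2 l1.
- by move=> n X X0; rewrite tens_id_comp //; apply/c1/c2.
- by move=> X; rewrite t1 t2.
Qed.

(** For bijective f this is conjugation by a permutation unitary. It serves both to identify
    registers and to negate messages. *)
Definition relabel I J (f : J -> I) : op R I -> op R J := fun X x y => X (f x) (f y).

Lemma relabel_CPTP I J (f : J -> I) : bijective f -> CPTP (relabel f).
Proof.
move=> bf; have -> : relabel f = kraus_map (fun (_ : unit) x a => (f x == a)%:R).
  apply: funext => X; apply: opP => x y; rewrite /kraus_map big_const card_unit /= addr0.
  rewrite (bigD1 (f x)) //= [X in _ + X]big1 ?addr0 => [|a]; last first.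
    by rewrite eq_sym => /negbTE ->; rewrite big1 // => b _; rewrite !mul0r.
  rewrite (bigD1 (f y)) //= big1 ?addr0 => [|a].
    by rewrite !eqxx conjC1 mulr1 mul1r.
  by rewrite eq_sym => /negbTE ->; rewrite conjC0 mulr0.
apply: kraus_map_CPTP => x y; rewrite big_const card_unit /= addr0.
case: bf => g fg gf; rewrite (bigD1 (g x)) //= gf eqxx conjC1 mul1r big1 ?addr0 //.
move=> z zx; rewrite (_ : (f z == x) = false) ?conjC0 ?mul0r //.
by apply: contraNF zx => /eqP <-; rewrite fg.
Qed.

Lemma id_CPTP I : CPTP (fun X : op R I => X).
Proof. exact: (relabel_CPTP (f := id) (Bijective (fun=> erefl) (fun=> erefl))). Qed.

End Channels.

(** * Isolating one share *)

(** Distributivity for dependent families, obtained through [fprod] from the version for functions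
    into the tagged union of the T_ i. *)
Lemma prod_sum_dffun (S : comPzSemiRingType) (I : finType) (T_ : I -> finType)
    (F : forall i, T_ i -> S) :
  \prod_i \sum_j F i j = \sum_(t : {dffun forall i, T_ i}) \prod_i F i (t i).
Proof.
rewrite (reindex (@dffun_of_fprod I T_)); last first.
  by exists (@fprod_of_dffun I T_) => x _; rewrite (dffun_of_fprodK, fprod_of_dffunK).
have ff i : ([ffun x => F i x] : {ffun T_ i -> S}) = F i :> (T_ i -> S).
  by apply: funext => x; rewrite ffunE.
under eq_bigr => i _ do rewrite (big_tag F i) -ff.
rewrite bigA_distr_big_dep -(big_fprod 1 +%R (fun i => [ffun x => F i x])).
apply: eq_bigr => t _.
by apply: eq_bigr => i _; rewrite /dffun_of_fprod !ffunE.
Qed.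

Section Shares.
Variable R : realType.
Local Notation C := (R[i]).
Variables (t : nat) (q : 'I_t -> nat) (i : 'I_t).

(** Basis of the shares other than i: a configuration of them is encoded as a full codeword index
    whose share i is pinned to zero. *)
Definition rest : finType := {x : cw q | x i == [ffun=> false]}.

Definition with_share (x : cw q) (a : qreg (q i)) : cw q :=
  finfun (fun j => eqtype.dfwith (T := fun j => qreg (q j)) (fun j => x j) a j).

Definition glue (p : qreg (q i) * rest) : cw q := with_share (val p.2) p.1.

Lemma with_share_in x a : with_share x a i = a.
Proof. by rewrite ffunE eqtype.dfwith_in. Qed.

Lemma with_share_out x a j : i != j -> with_share x a j = x j.
Proof. by move=> ij; rewrite ffunE eqtype.dfwith_out. Qed.

Lemma with_share_zero x : with_share x [ffun=> false] i == [ffun=> false].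
Proof. by rewrite with_share_in. Qed.

Definition unglue (x : cw q) : qreg (q i) * rest :=
  (x i, exist (fun x : cw q => x i == [ffun=> false]) _ (with_share_zero x)).

Lemma glueK : cancel glue unglue.
Proof.
move=> [a [b b0]]; rewrite /unglue /glue /= with_share_in; congr (_, _).
apply: val_inj => /=; apply/ffunP => j.
case: (eqVneq i j) => [<-|ij]; first by rewrite with_share_in (eqP b0).
by rewrite !with_share_out.
Qed.

Lemma unglueK : cancel unglue glue.
Proof.
move=> x; apply/ffunP => j; rewrite /glue /=.
case: (eqVneq i j) => [<-|ij]; first by rewrite with_share_in.
by rewrite !with_share_out.
Qed.

Lemma glue_bij : bijective glue.
Proof. exact: Bijective glueK unglueK. Qed.

Lemma card_qreg m : #|qreg m| = (2 ^ m)%N.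
Proof. by rewrite card_ffun card_bool card_ord. Qed.

Lemma card_cw : #|cw q| = (2 ^ blocklength q)%N.
Proof.
rewrite card_dep_ffun /blocklength /image_mem foldrE big_map big_enum /=.
rewrite (big_morph (fun m => 2 ^ m)%N (id1 := 1%N) (op1 := muln)) //.
  by apply: eq_bigr => j _; rewrite card_qreg.
by move=> x y; rewrite expnD.
Qed.

Lemma card_rest : (2 ^ q i * #|rest| = 2 ^ blocklength q)%N.
Proof.
by rewrite -card_cw -(card_qreg (q i)) -card_prod; apply: bij_eq_card glue_bij.
Qed.

Definition single_share (Phi : op R (qreg (q i)) -> op R (qreg (q i))) j :
    op R (qreg (q j)) -> op R (qreg (q j)) :=
  eqtype.dfwith (T := fun j => op R (qreg (q j)) -> op R (qreg (q j))) (fun j X => X) Phi j.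

Arguments single_share Phi j _ : clear implicits.

Lemma prod_rest (p r : qreg (q i) * rest) :
  \prod_(j | j != i) ((glue p j == glue r j)%:R : C) = (p.2 == r.2)%:R.
Proof.
case: (eqVneq p.2 r.2) => [e|ne] /=.
  apply: big1 => j; rewrite eq_sym => ij.
  by rewrite /glue !with_share_out // e eqxx.
have [/forallP e|/forallPn [j]] := boolP [forall j, (j != i) ==> (glue p j == glue r j)].
  case/eqP: ne; apply: val_inj; apply/ffunP => j.
  case: (eqVneq j i) => [->|ji]; first by rewrite (eqP (valP p.2)) (eqP (valP r.2)).
  have := e j; rewrite ji implyTb /glue !with_share_out 1?eq_sym // => /eqP //.
rewrite negb_imply => /andP[ji /negbTE jn].
by rewrite (bigD1 j) //= jn mul0r.
Qed.

(** The identity maps on the other shares contribute Kronecker deltas, which by [prod_rest] force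
    the [rest] components to agree. *)
Lemma lo_tensor_single (Phi : op R (qreg (q i)) -> op R (qreg (q i))) X u v :
  lo_tensor (single_share Phi) X (glue u) (glue v) =
  tens_id Phi (fun u v => X (glue u) (glue v)) u v.
Proof.
rewrite /lo_tensor (reindex glue) /=; last exact/onW_bij/glue_bij.
have step p r : \prod_j single_share Phi j (eunit R (glue p j) (glue r j))
      (glue u j) (glue v j) =
    Phi (eunit R p.1 r.1) u.1 v.1 * ((u.2 == p.2)%:R * (v.2 == r.2)%:R).
  rewrite (bigD1 i) //= /single_share eqtype.dfwith_in /glue !with_share_in; congr (_ * _).
  rewrite -(prod_rest u p) -(prod_rest v r) -big_split; apply: eq_bigr => j ji /=.
  rewrite eqtype.dfwith_out; last by rewrite eq_sym.
  by rewrite /eunit /glue -natrM mulnb.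
rewrite sum_pair; apply: eq_bigr => a _.
rewrite (bigD1 u.2) //= [X in _ + X]big1 ?addr0; last first.
  move=> b; rewrite eq_sym => /negbTE bu; rewrite (reindex glue) /=; last exact/onW_bij/glue_bij.
  by rewrite big1 // => r _; rewrite step /= bu mul0r !mulr0.
rewrite (reindex glue) /=; last exact/onW_bij/glue_bij.
rewrite sum_pair; apply: eq_bigr => a' _.
rewrite (bigD1 v.2) //= [X in _ + X]big1 ?addr0.
  by rewrite step /= !eqxx !mulr1.
by move=> b; rewrite eq_sym => /negbTE bv; rewrite step /= bv !mulr0.
Qed.

Lemma single_share_LO Phi : CPTP Phi -> in_LO (lo_tensor (single_share Phi)).
Proof.
move=> P; exists (single_share Phi); split => // j; rewrite /single_share.
case: eqtype.dfwithP => // k _.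
exact: id_CPTP.
Qed.

(** Writing every local state as S S^dagger with S its square root turns it into a sum over columns
    of S. Expanding the product over shares gives product vectors, indexed by a mixture component
    and one column per share; they need not be normalized. *)
Lemma separable_across (rho : op R (cw q)) : separable rho ->
  exists (K : finType) (w : K -> C) (alpha : K -> qreg (q i) -> C) (beta : K -> rest -> C),
   (forall r, 0 <= w r) /\
   forall u v, rho (glue u) (glue v) =
     \sum_r w r * (tensv (alpha r) (beta r) u * (tensv (alpha r) (beta r) v)^*).
Proof.
case=> m [w [r [w0 _ rd ->]]].
pose S j l := psd_sqrt (r j l).
have Sp j l : psd (S j l) /\ opmul (S j l) (S j l) = r j l.
  by apply: psd_sqrtP; case: (rd j l).
have rE j l x y : r j l x y = \sum_z S j l x z * (S j l y z)^*.
  case: (Sp j l) => S0 <-; apply: eq_bigr => z _.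
  by rewrite -(posform_herm S0).
exists ('I_m * cw q)%type, (fun p : 'I_m * cw q => (w p.1)%:C%C),
  (fun (p : 'I_m * cw q) a => S p.1 i a (p.2 i)),
  (fun (p : 'I_m * cw q) (b : rest) => \prod_(l | l != i) S p.1 l (val b l) (p.2 l)); split.
  by move=> p; rewrite lecR.
move=> u v; rewrite [RHS]sum_pair; apply: eq_bigr => j _; rewrite /= -mulr_sumr; congr (_ * _).
under eq_bigr => l _ do rewrite rE.
rewrite (prod_sum_dffun (fun l z => S j l (glue u l) z * (S j l (glue v l) z)^*)).
apply: eq_bigr => z _.
have prodE u0 : tensv (fun a => S j i a (z i))
    (fun b : rest => \prod_(l | l != i) S j l (val b l) (z l)) u0 =
    \prod_l S j l (glue u0 l) (z l).
  rewrite (bigD1 i) //= /tensv /glue with_share_in; congr (_ * _).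
  by apply: eq_bigr => l li; rewrite with_share_out // eq_sym.
by rewrite /= !prodE rmorph_prod -big_split.
Qed.

Lemma tens_id_kraus_mixture (S K : finType) (Kr : S -> qreg (q i) -> qreg (q i) -> C)
   (w : K -> C) (alpha : K -> qreg (q i) -> C) (beta : K -> rest -> C) u v :
  tens_id (kraus_map Kr) (fun u v =>
     \sum_r w r * (tensv (alpha r) (beta r) u * (tensv (alpha r) (beta r) v)^*)) u v =
  \sum_r \sum_s w r * (tensv (app (Kr s) (alpha r)) (beta r) u *
       (tensv (app (Kr s) (alpha r)) (beta r) v)^*).
Proof.
rewrite /tens_id.
under eq_bigr => a _.
  under eq_bigr => b _ do rewrite mulr_suml.
  rewrite exchange_big /=.
over.
rewrite /= exchange_big; apply: eq_bigr => r _ /=.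
under eq_bigr => a _.
  under eq_bigr => b _ do rewrite kraus_map_eunit mulr_sumr.
  rewrite exchange_big /=.
over.
rewrite /= exchange_big; apply: eq_bigr => s _ /=.
rewrite /tensv /= mulr_suml mulr_suml mulr_sumr; apply: eq_bigr => a _.
rewrite rmorphM rmorph_sum /= mulr_suml !mulr_sumr; apply: eq_bigr => b _.
by rewrite !rmorphM /=; ring.
Qed.

End Shares.

(** * The bound *)

(** [N m m'] is the probability that m' survives the attack on m, and [h m m'] the weight of P_m on
    the codeword of m'. The diagonal forces p_m <= 1/4 + s_m + eps; off the diagonal gamma_m
    supplies total mass at most 1 per row, so most messages could not survive unless eps is
    large. *)
Lemma averaged_bound (F : realFieldType) (M : finType) (N h gam : M -> M -> F)
    (s p : M -> F) (d eps : F) :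
  (forall m, N m m <= 4^-1 + s m) ->
  (forall m m', 1 - 2 * h m m' <= N m m') ->
  (forall m', \sum_m h m m' <= 4 * d) ->
  \sum_m s m = d -> 1 <= d -> 16 * d <= #|M|%:R ->
  (forall m, 0 <= p m <= 1) -> (forall m, \sum_m' gam m m' = 1) ->
  (forall m m', 0 <= gam m m') ->
  (forall m m', `|N m m' - (p m + (1 - p m) * gam m m')| <= eps) ->
  16^-1 <= eps.
Proof.
move=> Nle Nge hs sd d1 dM p01 g1 g0 NM; set D : F := #|M|%:R in dM.
have sumc (c : F) : \sum_(m : M) c = D * c by rewrite sumr_const mulr_natl.
have pB m : p m <= 4^-1 + s m + eps.
  have := NM m m; rewrite ler_norml => /andP[h1 _].
  have := Nle m; have : 0 <= (1 - p m) * gam m m.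
    by rewrite mulr_ge0 ?subr_ge0; case/andP: (p01 m).
  by lra.
have row m : \sum_m' (1 - 2 * h m m') <= D * (4^-1 + s m + eps) + 1 + D * eps.
  apply: le_trans (_ : \sum_m' (p m + (1 - p m) * gam m m' + eps) <= _).
    apply: ler_sum => m' _; apply: le_trans (Nge m m') _.
    by have := NM m m'; rewrite ler_norml => /andP[_]; lra.
  rewrite !big_split /= !sumc -mulr_sumr g1 mulr1.
  have D0 : 0 <= D by apply: ler0n.
  have := ler_wpM2l D0 (pB m); have /andP[] := p01 m; lra.
have tot : D * D - 2 * (D * (4 * d)) <=
    D * (D * 4^-1) + D * d + D * (D * eps) + D + D * (D * eps).
  apply: le_trans (_ : \sum_m \sum_m' (1 - 2 * h m m') <= _).
    under eq_bigr => m _ do rewrite sumrB sumc mulr1 -mulr_sumr.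
    rewrite sumrB sumc -mulr_sumr lerD2l lerN2 ler_wpM2l //.
    rewrite exchange_big /= -sumc; exact: ler_sum.
  apply: le_trans (ler_sum _ (fun m _ => row m)) _.
  rewrite !big_split /= -mulr_sumr !big_split /= !sumc sd.
  by rewrite !mulrDr mulr1; lra.
have D1 : 0 < D by lra.
have {}tot : D * (D - 8 * d) <= D * (D * 4^-1 + d + 1 + 2 * (D * eps)) by lra.
rewrite ler_pM2l // in tot.
(* Now 3D/4 - 9d - 1 <= 2 D eps; with 1 <= d <= D/16 the left side is at least D/8. *)
have : D * 16^-1 <= D * eps by lra.
by rewrite ler_pM2l.
Qed.

(** * Bounds on the error of a non-malleable code *)

Section Codes.
Variable R : realType.
Local Notation C := (R[i]).
Variables (k t : nat) (q : 'I_t -> nat).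
Variables (Enc : op R (qreg k) -> op R (cw q)) (Dec : op R (cw q) -> op R (qreg k)).

(** Perfect decoding of the codeword of m forces Tr E_m >= 1, and the 2^k effects sum to the
    identity, of trace 2^n. *)
Lemma code_dimension : qcode Enc Dec -> (k <= blocklength q)%N.
Proof.
move=> [Enc_c Dec_c DE].
have tr1 m : 1 <= \sum_x effect Dec m x x.
  have rho0 : psd (Enc (eunit R m m)).
    by case: Enc_c => l c _; exact: (completely_positive_psd l c (eunit_psd m)).
  have [d [e [d0 [orth be] rhoE]]] := posform_specP rho0.
  have rhoE' : Enc (eunit R m m) = fun x y => \sum_z d z * (e z x * (e z y)^*).
    exact: opP.
  have e1 : \sum_z d z * form (effect Dec m) (e z) (e z) = 1.
    rewrite -effect_mixture -?rhoE' ?DE ?/eunit ?eqxx //; by case: Dec_c.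
  have trd : \sum_z d z = 1.
    case: Enc_c => _ _ tp; have := tp (eunit R m m).
    rewrite trace_eunit eqxx /trace.
    under eq_bigr => x _ do rewrite rhoE /spec.
    rewrite exchange_big /= => tr1; apply: (etrans _ tr1); apply: eq_bigr => z _.
    rewrite -mulr_sumr; under eq_bigr => x _ do rewrite mulrC.
    by rewrite -/(inner _ _) orth eqxx mulr1.
  suff : \sum_z d z * form (effect Dec m) (e z) (e z) <=
      (\sum_z d z) * \sum_x effect Dec m x x by rewrite e1 trd mul1r.
  rewrite mulr_suml; apply: ler_sum => z _.
  apply: ler_wpM2l => //.
  have := form_le_trace (e z) (effect_posform m Dec_c).
  by rewrite orth eqxx mulr1.
have : \sum_(m : qreg k) 1 <= \sum_m \sum_x effect Dec m x x by apply: ler_sum.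
rewrite exchange_big /=; under [leRHS]eq_bigr => x _ do rewrite sum_effect // eqxx.
by rewrite !sum_const !mul1r ler_nat card_qreg card_cw leq_exp2l.
Qed.

Lemma Re_le (x y : C) : x <= y -> complex.Re x <= complex.Re y.
Proof. by rewrite lecE => /andP[]. Qed.

Variable i : 'I_t.

Local Notation E := (fun m u v => effect Dec m (@glue t q i u) (glue v)).

Lemma form_glue m (v : qreg (q i) * rest q i -> C) :
  form (effect Dec m) (fun x => v (unglue i x)) (fun x => v (unglue i x)) =
  form (E m) v v.
Proof.
rewrite /form (reindex (@glue t q i)) /=; last exact/onW_bij/glue_bij.
apply: eq_bigr => u _.
rewrite (reindex (@glue t q i)) /=; last exact/onW_bij/glue_bij.
by apply: eq_bigr => w _; rewrite !glueK.
Qed.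

Lemma posform_glue m : CPTP Dec -> posform (E m).
Proof. by move=> D v; rewrite -form_glue; apply: effect_posform. Qed.

Lemma glue_le1 m v : CPTP Dec -> form (E m) v v <= inner v v.
Proof.
move=> D; rewrite -form_glue; apply: le_trans (effect_le1 _ _ D) _.
rewrite /inner (reindex (@glue t q i)) /=; last exact/onW_bij/glue_bij.
by under eq_bigr => u _ do rewrite glueK.
Qed.

Lemma sum_glue u v : CPTP Dec -> \sum_m E m u v = (u == v)%:R.
Proof.
by move=> D; rewrite sum_effect // (inj_eq (bij_inj (glue_bij q i))).
Qed.

Lemma effect_mixture_glue (K : finType) (w : K -> C)
    (V : K -> qreg (q i) * rest q i -> C) (X : op R (cw q)) m :
  is_linear Dec ->
  (forall u v, X (glue u) (glue v) = \sum_r w r * (V r u * (V r v)^*)) ->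
  Dec X m m = \sum_r w r * form (E m) (V r) (V r).
Proof.
move=> lin XE.
have -> : X = fun x y => \sum_r w r * (V r (unglue i x) * (V r (unglue i y))^*).
  by apply: opP => x y; rewrite -XE !unglueK.
rewrite (effect_mixture _ (fun r x => V r (unglue i x)) _ lin).
by apply: eq_bigr => r _; rewrite form_glue.
Qed.

Lemma attack_outcome (S K : finType) (Kr : S -> qreg (q i) -> qreg (q i) -> C)
   (w : K -> C) (alpha : K -> qreg (q i) -> C) (beta : K -> rest q i -> C) X m :
  is_linear Dec ->
  (forall u v, X (glue u) (glue v) =
     \sum_r w r * (tensv (alpha r) (beta r) u * (tensv (alpha r) (beta r) v)^*)) ->
  Dec (lo_tensor (single_share (kraus_map (R := R) Kr)) X) m m =
  outcome (E m) Kr w alpha beta.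
Proof.
move=> lin XE.
rewrite (@effect_mixture_glue (K * S)%type (fun p => w p.1)
  (fun p => tensv (app (Kr p.2) (alpha p.1)) (beta p.1))) //.
  rewrite sum_pair; apply: eq_bigr => r _.
  by rewrite mulr_sumr.
move=> u v; rewrite lo_tensor_single.
have -> : (fun u v => X (glue u) (glue v)) = fun u v =>
    \sum_r w r * (tensv (alpha r) (beta r) u * (tensv (alpha r) (beta r) v)^*).
  by apply: opP => x y; rewrite XE.
by rewrite tens_id_kraus_mixture sum_pair.
Qed.

Lemma small_complement_bound (eps : R) : qcode Enc Dec -> nonmalleable Enc Dec eps ->
  (forall psi, density psi -> separable (Enc psi)) ->
  (16 * #|rest q i| <= 2 ^ k)%N -> 16^-1 <= eps.
Proof.
move=> [Enc_c Dec_c DE] NM sep dims.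
have Dlin : is_linear Dec by case: Dec_c.
have A0 : (0 < #|qreg (q i)|)%N by rewrite card_qreg expn_gt0.
have Ep m : posform (E m) by apply: posform_glue.
(* This threshold gives the term 1/4 in the bound on [N m m] and the factor 4 in the bound on the
   sum of h. *)
pose tau : C := ((4^-1)%:C)%C.
have tau0 : 0 < tau by rewrite ltcR invr_gt0.
have [P HP] := choice (fun m => threshold_projector (posform_ptr2 (Ep m)) tau0).
have projP m : projector (P m) by case: (HP m).
pose Lam m := lo_tensor (single_share (kraus_map (R := R) (attack (P m)))).
have LO m : in_LO (Lam m).
  by apply/single_share_LO/kraus_map_CPTP/attack_kraus.
have [p Hp] := choice (fun m => nonmalleable_diag NM (LO m)).
have [gam Hg] := choice Hp.
pose N m m' := complex.Re (Dec (Lam m (Enc (eunit R m' m'))) m' m').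
pose s m := complex.Re ((\sum_u E m u u) / #|qreg (q i)|%:R).
(* One product decomposition of the codeword of m' serves all attacks m at once, so that the weights
   of the P_m on it can be summed. *)
have state m' : exists h : qreg k -> R,
    [/\ N m' m' <= 4^-1 + s m', forall m, 1 - 2 * h m <= N m m' &
        \sum_m h m <= 4 * #|rest q i|%:R].
  have [K [w [alpha [beta [w0 rhoE]]]]] := separable_across i (sep _ (eunit_density R m')).
  have w1 : \sum_r w r * (inner (alpha r) (alpha r) * inner (beta r) (beta r)) = 1.
    case: Enc_c => _ _ tp; have := tp (eunit R m' m').
    rewrite trace_eunit eqxx /trace (reindex (@glue t q i)) /=; last exact/onW_bij/glue_bij.
    under eq_bigr => u _ do rewrite rhoE.
    rewrite exchange_big /= => tr1; apply: (etrans _ tr1); apply: eq_bigr => r _.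
    rewrite -mulr_sumr -inner_tensv; congr (_ * _); apply: eq_bigr => u _.
    by rewrite mulrC.
  have wE : \sum_r w r * form (E m') (tensv (alpha r) (beta r)) (tensv (alpha r) (beta r)) = 1.
    by rewrite -(effect_mixture_glue _ Dlin rhoE) DE /eunit eqxx.
  have NE m : N m m' = complex.Re (outcome (E m') (attack (P m)) w alpha beta).
    by rewrite /N /Lam (attack_outcome _ _ Dlin rhoE).
  exists (fun m => complex.Re (\sum_r w r * (inner (app (P m) (alpha r)) (app (P m) (alpha r))
                        * inner (beta r) (beta r)))); split.
  - rewrite NE; case: (HP m') => _ _ _ Pt.
    have := Re_le (outcome_attack_le A0 (Ep m') (projP m') Pt w0 w1).
    by rewrite raddfD.
  - move=> m; rewrite NE.
    have := Re_le (outcome_attack_ge A0 (Ep m') (fun v => glue_le1 m' v Dec_c) (projP m) w0 w1 wE).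
    by rewrite mulr_natl raddfB raddfMn /= mulr_natl.
  - have Pt m v : tau * inner (app (P m) v) (app (P m) v) <= form (ptr2 (E m)) v v.
      by case: (HP m).
    have := sum_projector_le (fun x y => sum_glue x y Dec_c) Pt w0 w1.
    rewrite -(ler_pM2l (_ : 0 < (4%:R%:C)%C :> C)) ?ltcR // mulrA -rmorphM mulfV ?pnatr_eq0 //.
    rewrite rmorph1 mul1r => /Re_le; rewrite raddf_sum => /le_trans; apply.
    by rewrite -(rmorph_nat (real_complex R)) -rmorphM.
have [h Hh] := choice state.
have ss : \sum_m s m = #|rest q i|%:R.
  rewrite -raddf_sum -mulr_suml exchange_big /=.
  under eq_bigr => u _ do rewrite (sum_glue _ _ Dec_c) eqxx.
  rewrite sum_const mul1r card_prod natrM mulrAC divff ?mul1r; last first.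
    by rewrite pnatr_eq0 -lt0n.
  by rewrite -(rmorph_nat (real_complex R)).
(* [h] takes the encoded message first and the attacked one second, hence the swap. *)
apply: (@averaged_bound R (qreg k) N (fun m m' => h m' m) gam s p #|rest q i|%:R).
- by move=> m; case: (Hh m).
- by move=> m m'; case: (Hh m').
- by move=> m'; case: (Hh m').
- exact: ss.
- rewrite ler1n lt0n; apply: contraPneq (card_rest q i) => ->.
  by apply/eqP; rewrite muln0 eq_sym expn_eq0.
- by rewrite card_qreg -natrM ler_nat.
- by move=> m; case: (Hg m).
- by move=> m; case: (Hg m).
- by move=> m m'; case: (Hg m).
- move=> m m'; case: (Hg m) => _ _ _ /(_ m' m').
  by rewrite eqxx mulr1.
Qed.

(** Already for the identity attack, eps bounds an absolute value. *)
Lemma nonmalleable_ge0 (eps : R) : nonmalleable Enc Dec eps -> 0 <= eps.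
Proof.
move=> NM.
have idC : CPTP (fun X : op R (qreg (q i)) => X).
  exact: id_CPTP.
have [p [g [_ _ _ H]]] := nonmalleable_diag NM (single_share_LO idC).
exact: le_trans (normr_ge0 _) (H [ffun=> false] [ffun=> false]).
Qed.

(* With a single nontrivial share the adversary can decode, negate the
   message, and encode again. *)
Lemma trivial_complement_bound (eps : R) : qcode Enc Dec -> nonmalleable Enc Dec eps ->
  #|rest q i| = 1%N -> (0 < k)%N -> 2^-1 <= eps.
Proof.
move=> [Enc_c Dec_c DE] NM rest1 k0.
have /fintype1P [b0 rest_b0] : #|rest q i| == 1%N by rewrite rest1.
pose flip (x : qreg k) : qreg k := [ffun j => ~~ x j].
have flipK : involutive flip.
  by move=> x; apply/ffunP => j; rewrite !ffunE negbK.
(* As [rest] has the single element [b0], the maps [f1] and [f2] identify share i with the whole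
   codeword register. *)
pose f1 (a : qreg (q i)) : cw q := glue (a, b0).
pose f2 (x : cw q) : qreg (q i) := x i.
have f1K : cancel f1 f2 by move=> a; rewrite /f1 /f2 with_share_in.
have f2K : cancel f2 f1.
  by move=> x; rewrite /f1 -[RHS](@unglueK t q i x) /unglue; congr (glue (_, _)).
pose Phi X := relabel f1 (Enc (relabel flip (Dec (relabel f2 X)))).
have PhiC : CPTP Phi.
  apply: CPTP_comp (relabel_CPTP R _) _; first by exists f2.
  apply: CPTP_comp Enc_c _; apply: CPTP_comp (relabel_CPTP R _) _; first by exists flip.
  by apply: CPTP_comp Dec_c (relabel_CPTP R _); exists f1.
have LamE X : lo_tensor (single_share Phi) X = Enc (relabel flip (Dec X)).
  apply: opP => x y; rewrite -(f2K x) -(f2K y) /f1 lo_tensor_single /tens_id /=.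
  case: (PhiC) => lin _ _.
  rewrite -(is_linear_expand (fun a b => X (glue (a, b0)) (glue (b, b0))) _ _ lin).
  rewrite /Phi; congr (Enc (relabel flip (Dec _)) _ _).
  by apply: opP => u v; rewrite /relabel -/(f1 _) -/(f1 _) !f2K.
have [p [g [/andP[p0 p1] g0 g1 H]]] := nonmalleable_diag NM (single_share_LO PhiC).
have flip_neq m : flip m != m.
  by apply/eqP => /ffunP/(_ (Ordinal k0)); rewrite ffunE; case: (m _).
(* The message [flip m] comes out as m with certainty, and the p-term puts no mass on m. *)
have key m : 1 - eps <= (1 - p) * g m.
  have := H (flip m) m; rewrite LamE DE !DE /relabel /eunit eqxx.
  rewrite eq_sym (negbTE (flip_neq m)) mulr0 add0r ler_norml => /andP[_] /=; lra.
(* Two distinct outputs share the mass of gamma, so adding their [key] bounds gives 2 (1 - eps) <=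
   1. *)
have gg : g (flip [ffun=> false]) + g [ffun=> false] <= 1.
  rewrite -g1 (bigD1 (flip [ffun=> false])) //= lerD2l (bigD1 [ffun=> false]) //=.
    by rewrite lerDl sumr_ge0.
  by rewrite eq_sym flip_neq.
have : (1 - p) * (g (flip [ffun=> false]) + g [ffun=> false]) <= 1 * 1.
  by apply: ler_pM; rewrite ?subr_ge0 ?addr_ge0 // gerBl.
have := key (flip [ffun=> false]); have := key [ffun=> false]; lra.
Qed.

End Codes.

(** Pigeonhole: if t q_i + 1 <= n for all i, summing gives t n + t <= t n, so t = 0 and n = 0. *)
Lemma exists_large_share (t : nat) (q : 'I_t -> nat) : (0 < blocklength q)%N ->
  exists i, (blocklength q <= t * q i)%N.
Proof.
move=> n0; case: (pickP (fun i => blocklength q <= t * q i)%N) => [i|small].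
  by exists i.
have : (\sum_(i < t) (t * q i).+1 <= \sum_(i < t) blocklength q)%N.
  by apply: leq_sum => i _; rewrite ltnNge small.
under eq_bigr => i _ do rewrite -addn1.
rewrite big_split /= -big_distrr /= !sum_nat_const card_ord -/(blocklength q) muln1.
rewrite -[leqRHS]addn0 leq_add2l leqn0 => /eqP t0.
by move: n0; rewrite /blocklength; case: t t0 q {small} => // _ q; rewrite big_ord0.
Qed.

Theorem theorem10p1 (R : realType) :
  exists c : R, 0 < c /\
  forall (k t : nat) (q : 'I_t -> nat)
         (Enc : op R (qreg k) -> op R (cw q)) (Dec : op R (cw q) -> op R (qreg k))
         (eps delta : R),
    (0 < blocklength q)%N ->
    qcode Enc Dec ->
    nonmalleable Enc Dec eps ->
    (forall psi : op R (qreg k), density psi -> separable (Enc psi)) ->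
    1 - (t%:R)^-1 + delta <= k%:R / (blocklength q)%:R ->
    4 * (ln (blocklength q)%:R / ln 2) / (blocklength q)%:R <= delta ->
    c * delta ^+ 2 <= eps.
Proof.
(* Since delta <= 1, it is enough to show eps >= 1/16, apart from a degenerate case with delta =
   0. *)
exists 16^-1; split; first by rewrite invr_gt0.
move=> k t q Enc Dec eps delta n0 code NM sep rate dlog.
have [i ti] := exists_large_share n0.
have kn := code_dimension code; have cr := card_rest q i.
have eps0 := nonmalleable_ge0 i NM.
set n := blocklength q in n0 rate dlog ti kn cr.
have t0 : (0 < t)%N by case: (t) (i) => // -[].
have tR : (1 : R) <= t%:R by rewrite ler1n.
have nR : (0 : R) < n%:R by rewrite ltr0n.
have ti' : (n%:R : R) / t%:R <= (q i)%:R.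
  by rewrite ler_pdivrMr ?ltr0n // -natrM ler_nat mulnC.
have tinv : (t%:R : R)^-1 <= 1 by rewrite invf_le1 // (lt_le_trans ltr01).
have d1 : delta <= 1.
  have : (k%:R : R) / n%:R <= 1 by rewrite ler_pdivrMr // mul1r ler_nat.
  by lra.
have ln2 : 0 < ln 2 :> R by rewrite ln_gt0 // ltr1n.
have d0 : 0 <= delta.
  have lnn : 0 <= ln n%:R :> R by rewrite ln_ge0 // ler1n.
  apply: le_trans dlog; apply: divr_ge0; last by rewrite ler0n.
  by apply: mulr_ge0 => //; apply: divr_ge0 => //; apply: ltW.
have d2 : 16^-1 * delta ^+ 2 <= 16^-1.
  by rewrite ler_piMr ?invr_ge0 // expr_le1.
have rate' : n%:R - n%:R / t%:R + delta * n%:R <= k%:R :> R.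
  by move: rate; rewrite ler_pdivlMr // mulrDl mulrBl mul1r [_^-1 * _]mulrC.
have [n1|n2] := leqP n 1.
- have n1E : n = 1%N by apply/eqP; rewrite eqn_leq n1 n0.
  have rest1 : #|rest q i| = 1%N.
    have q0 : (0 < q i)%N.
      by rewrite lt0n; apply: contraTneq ti => ->; rewrite muln0 -ltnNge.
    move: cr; rewrite n1E; case: (q i) q0 => // m _.
    rewrite expnS expn1 -mulnA => /eqP.
    by rewrite -[X in _ == X]muln1 eqn_pmul2l // muln_eq1 => /andP[_ /eqP].
  (* With k = 0 and n = 1 the rate condition reads 1 - 1/t + delta <= 0, so delta = 0 and eps >= 0
     suffices. *)
  have [k0|k0] := posnP k.
    move: rate'; rewrite k0 n1E mulr1 mul1r => rate'.
    have -> : delta = 0 by lra.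
    by rewrite expr0n mulr0.
  by have := trivial_complement_bound code NM rest1 k0; lra.
- apply: le_trans d2 _; apply: (small_complement_bound (i := i) code NM sep).
  (* The hypothesis gives delta n >= 4 log_2 n, and n >= 2. *)
  have dn : 4 <= delta * n%:R.
    have : 4 * (ln n%:R / ln 2) <= delta * n%:R by rewrite -ler_pdivrMr.
    apply: le_trans; rewrite ler_peMr // ler_pdivlMr // mul1r.
    by rewrite ler_ln ?posrE ?ltr0n // ler_nat.
  (* From k >= n - n/t + delta n with n/t <= q_i and delta n >= 4. The surplus of 4 qubits is the
     factor 16 = 2^4 between 2^k and the dimension of [rest]. *)
  have kq : (n + 4 <= k + q i)%N by rewrite -(ler_nat R) !natrD; lra.
  rewrite -(@leq_pmul2l (2 ^ q i)) ?expn_gt0 // mulnCA cr mulnC -[16%N]/(2 ^ 4)%N.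
  by rewrite -!expnD leq_exp2l // [leqRHS]addnC.
Qed.
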